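(* Let $\mu^B\colon\mathbb B\to\mathbb A$ be a covering and $\mu^C\colon\mathbb C\to\mathbb A$ an immersion of graphs of groups, with $\mathbb B$ and $\mathbb C$ connected. Fix vertices $u_0\in V(\mathsf A)$, $v_0\in V(\mathsf B)$, $w_0\in V(\mathsf C)$ with $\mu^B(v_0)=\mu^C(w_0)=u_0$ and let $A=\pi_1(\mathbb A,u_0)$, $B=\mu^B_*(\pi_1(\mathbb B,v_0))$, $C=\mu^C_*(\pi_1(\mathbb C,w_0))$. For each $v\in V(\mathsf B)$ fix a $\mathbb B$-path $p_v$ from $v_0$ to $v$, and for each $w\in V(\mathsf C)$ a $\mathbb C$-path $q_w$ from $w_0$ to $w$. Let $\mathbb D\subseteq\mathbb B\,\widetilde\times_{\mathbb A}\,\mathbb C$ be the union of the connected components of the $\mathbb A$-product with non-trivial fundamental group. Then the map sending a vertex $\mu^B(B_v)\,a\,\mu^C(C_w)\in V_{v,w}$ to the double coset $B\,(\mu^B(p_v)\,a\,\mu^C(q_w)^{-1})\,C$ induces a bijection from the set of connected components of $\mathbb D$ to the set of double cosets $\{BgC : g\in A,\ B^g\cap C\neq 1\}$.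
   Context: **Conventions.** For group elements, $x^g=g^{-1}xg$, $B^g=g^{-1}Bg$ and $\gamma_g(x)=x^g$. A graph $\mathsf A$ has a vertex set $V(\mathsf A)$, an edge set $E(\mathsf A)$, maps $o,t\colon E(\mathsf A)\to V(\mathsf A)$ and a fixed-point-free involution $e\mapsto e^{-1}$ on edges with $t(e^{-1})=o(e)$; graph morphisms preserve this structure. $\mathrm{Star}(v)$ is the set of edges with origin $v$. **Graphs of groups.** A graph of groups $\mathbb A$ consists of a graph $\mathsf A$, vertex groups $A_u$, edge groups $A_e=A_{e^{-1}}$, and monomorphisms $\alpha_e\colon A_e\to A_{o(e)}$, $\omega_e\colon A_e\to A_{t(e)}$ with $\omega_e=\alpha_{e^{-1}}$. It is connected if $\mathsf A$ is. **Paths.** An $\mathbb A$-path of length $k$ is a sequence $p=(a_0,e_1,a_1,\dots,e_k,a_k)$ where $(e_1,\dots,e_k)$ is a path in $\mathsf A$, $a_{i-1}\in A_{o(e_i)}$, $a_k\in A_{t(e_k)}$ (for $k=0$: $p=(a)$ with $a$ in a vertex group). Paths are concatenated by multiplying the adjacent group elements; $p^{-1}=(a_k^{-1},e_k^{-1},\dots,e_1^{-1},a_0^{-1})$; a circuit is a path with equal ends. The congruence $=_{\mathbb A}$ is generated by $(1,e,\omega_e(x),e^{-1},1)=_{\mathbb A}(\alpha_e(x))$, $x\in A_e$. The quotient of the category of $\mathbb A$-paths by $=_{\mathbb A}$ is the fundamental groupoid $\pi_1(\mathbb A)$; $\pi_1(\mathbb A,u)$ is the group of classes of circuits at $u$.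 **Morphisms.** A morphism $\mu\colon\mathbb B\to\mathbb A$ consists of a graph morphism $\mathsf B\to\mathsf A$ (also written $\mu$), monomorphisms $\mu_v\colon B_v\to A_{\mu(v)}$ and $\mu_f\colon B_f\to A_{\mu(f)}$, and, for each edge $f$ of $\mathsf B$, twisting elements $f_\alpha\in A_{\mu(o(f))}$, $f_\omega\in A_{\mu(t(f))}$ with $(f^{-1})_\alpha=f_\omega$ and $(f^{-1})_\omega=f_\alpha$, such that with $e=\mu(f)$, $v=o(f)$, $v'=t(f)$: $\alpha_e\circ\mu_f=\gamma_{f_\alpha}\circ\mu_v\circ\alpha_f$ and $\omega_e\circ\mu_f=\gamma_{f_\omega}\circ\mu_{v'}\circ\omega_f$. (We often omit subscripts on $\mu$.) It acts on paths by $\mu(b_0,f_1,b_1,\dots,f_k,b_k)=(\mu(b_0)(f_1)_\alpha,\mu(f_1),(f_1)_\omega^{-1}\mu(b_1)(f_2)_\alpha,\dots,\mu(f_k),(f_k)_\omega^{-1}\mu(b_k))$ and induces $\mu_*\colon\pi_1(\mathbb B,v)\to\pi_1(\mathbb A,\mu(v))$. **Immersions and coverings.** $\mu$ is an immersion if (i) for edges $f,f'$ of $\mathsf B$ with common origin $v$ and common image $e$, $f=f'$ if and only if $\mu_v(B_v)f_\alpha\alpha_e(A_e)=\mu_v(B_v)f'_\alpha\alpha_e(A_e)$; and (ii) for every edge $f$ with $v=o(f)$, $e=\mu(f)$: $\alpha_e(\mu_f(B_f))=\mu_v(B_v)^{f_\alpha}\cap\alpha_e(A_e)$. It is a covering if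 it is an immersion and for each vertex $v$ of $\mathsf B$ the map $\mathrm{Star}(v)\to\bigsqcup_{e\in\mathrm{Star}(\mu(v))}\mu(B_v)\backslash A_{\mu(v)}/\alpha_e(A_e)$, $f\mapsto\mu(B_v)f_\alpha\alpha_{\mu(f)}(A_{\mu(f)})$, is bijective. **The $\mathbb A$-product.** Given $\mu^B\colon\mathbb B\to\mathbb A$, $\mu^C\colon\mathbb C\to\mathbb A$, the $\mathbb A$-product $\mathbb E=\mathbb B\,\widetilde\times_{\mathbb A}\,\mathbb C$ is defined as follows. For vertices $v,w$ with $\mu^B(v)=\mu^C(w)=u$ let $V_{v,w}$ be the set of double cosets $\mu^B(B_v)\,a\,\mu^C(C_w)$, $a\in A_u$; for edges $f,g$ with $\mu^B(f)=\mu^C(g)=e$ let $E_{f,g}$ be the set of double cosets $\mu^B(B_f)\,a\,\mu^C(C_g)$, $a\in A_e$. The vertex set is $\bigsqcup V_{v,w}$ and the edge set is $\bigsqcup E_{f,g}$; the inverse of $h\in E_{f,g}$ is the same double coset viewed in $E_{f^{-1},g^{-1}}$; and the edge $\mu^B(B_f)\,a\,\mu^C(C_g)$ has origin $\mu^B(B_{o(f)})\,(f_\alpha\alpha_e(a)g_\alpha^{-1})\,\mu^C(C_{o(g)})$ and terminus $\mu^B(B_{t(f)})\,(f_\omega\omega_e(a)g_\omega^{-1})\,\mu^C(C_{t(g)})$. Fix representatives $\tilde x\in x$ and $\tilde h=\widetilde{h^{-1}}\in h$ of the double cosets, and for each $h\in E_{f,g}$ with $o(h)=x\in V_{v,w}$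 fix $b_h\in B_v$, $c_h\in C_w$ with $\tilde x=\mu^B(b_h)f_\alpha\alpha_e(\tilde h)g_\alpha^{-1}\mu^C(c_h)^{-1}$. The vertex group at $x$ is $\{(b,c)\in B_v\times C_w:\tilde x^{-1}\mu^B(b)\tilde x=\mu^C(c)\}$, the edge group at $h$ is $\{(b,c)\in B_f\times C_g:\tilde h^{-1}\mu^B(b)\tilde h=\mu^C(c)\}$, $\alpha_h(b,c)=(b_h\alpha_f(b)b_h^{-1},\,c_h\alpha_g(c)c_h^{-1})$, $\omega_h=\alpha_{h^{-1}}$. Different choices of representatives give isomorphic results. *)

(* Defs.v *)
From HB Require Import structures.
From mathcomp Require Import all_boot.
From mathcomp Require Import boolp classical_sets functions.

Set Implicit Arguments.
Unset Strict Implicit.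
Unset Printing Implicit Defensive.

Local Open Scope quotient_scope.
Local Open Scope classical_set_scope.
Local Open Scope group_scope.

Notation ghom := UMagmaMorphism.type.

Definition dcoset (G : groupType) (H K : set G) (g : G) : set G :=
  [set x | exists h k, [/\ H h, K k & x = h * g * k]].

Definition conj_set (G : groupType) (H : set G) (g : G) : set G :=
  [set x ^ g | x in H].

Section Pullback.
Variables (G H K : groupType) (phi : ghom G K) (psi : ghom H K) (k : K).

Definition pullback_pred : pred (G * H)%type :=
  fun x => phi x.1 ^ k == psi x.2.

Lemma pullback_closed : group_closed pullback_pred.
Proof.
split; first by apply/eqP; rewrite /= !gmulf1 conj1g.
move=> x y /eqP hx /eqP hy; apply/eqP => /=.
by rewrite !gmulfM !gmulfV conjMg conjVg hx hy.
Qed.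

Record pullback := Pullback {
  pullback_val :> (G * H)%type;
  pullbackP : pullback_pred pullback_val }.

HB.instance Definition _ := [isSub for pullback_val].
HB.instance Definition _ := [Choice of pullback by <:].
HB.instance Definition _ :=
  SubChoice_isSubGroup.Build (G * H)%type pullback_pred pullback
    pullback_closed.

End Pullback.

(* Edges are sorted by their end points: [edge u v] is the set of edges with
   origin [u] and terminus [v].  Since an edge with [u <> v] differs from its
   inverse for typing reasons, [einv_neq] concerns loops only. *)
Record graph := Graph {
  vertex :> Type;
  edge : vertex -> vertex -> Type;
  einv : forall u v, edge u v -> edge v u;
  einvK : forall u v (e : edge u v), einv (einv e) = e;
  einv_neq : forall u (e : edge u u), einv e <> e }.

Definition star (G : graph) (u : G) := {v : G & edge u v}.

Inductive walk (G : graph) (u : G) : G -> Prop :=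
| walk_nil : walk u u
| walk_cons v w : walk u v -> edge v w -> walk u w.

Definition connected (G : graph) := forall u v : G, walk u v.

Definition component (G : graph) (u : G) : set G := [set v | walk u v].

Definition components (G : graph) : set (set G) := range (@component G).

Arguments components : clear implicits.

Lemma orientation_exists (G : graph) :
  exists o : forall u v : G, edge u v -> bool,
    forall u v (e : edge u v), o v u (einv e) = ~~ o u v e.
Proof.
pose T := {u : G & {v : G & edge u v}}.
pose tg u v (e : edge u v) : T := existT _ u (existT _ v e).
pose ti (t : T) : T := tg _ _ (einv (projT2 (projT2 t))).
have tiK t : ti (ti t) = t by case: t => u [v e]; rewrite /ti /tg /= einvK.
have P (S : Type) (F : S -> Type) (s t : {z : S & F z}) : s = t ->
    exists E : projT1 s = projT1 t, eq_rect _ F (projT2 s) _ E = projT2 t.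
  by move=> ->; exists erefl.
have ti_neq t : ti t <> t.
  case: t => u [v e] /P /= [E]; case: u / E e => e /= /P /= [E].
  by rewrite (Prop_irrelevance E erefl) /= => /einv_neq.
have [c hc] : exists c : T -> T,
    forall t, c t = c (ti t) /\ (c t = t \/ c t = ti t).
  pose c (t : {classic T}) : {classic T} :=
    choose (fun s : {classic T} => (s == t) || (s == ti t)) t.
  exists c => t; split.
    pose Q (t s : {classic T}) := (s == t) || (s == ti t).
    have EP : Q (ti t) =1 Q t by move=> s; rewrite /Q tiK orbC.
    rewrite -[LHS]/(choose (Q t) t) -[RHS]/(choose (Q (ti t)) (ti t)).
    rewrite (eq_choose EP); apply: (@choose_id _ (Q t) t (ti t)).
      by rewrite /Q eqxx.
    by rewrite /Q eqxx orbT.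
  have := @chooseP _ (fun s : {classic T} => (s == t) || (s == ti t)) t.
  by rewrite eqxx => /(_ isT) /orP [] /eqP; [left|right].
exists (fun u v e => `[< c (tg u v e) = tg u v e >]) => u v e.
rewrite -asbool_neg; apply: asbool_equiv_eq.
have := hc (tg u v e); rewrite -[ti _]/(tg _ _ (einv e)) => -[<- [] ->].
  split=> [E|/(_ erefl) //]; case: (ti_neq (tg u v e)); exact: esym.
by split=> // _; exact: (ti_neq (tg u v e)).
Qed.

Record graph_mor (G H : graph) := GraphMor {
  gmor_v :> G -> H;
  gmor_e : forall u v, edge u v -> edge (gmor_v u) (gmor_v v);
  gmor_inv : forall u v (e : edge u v), gmor_e (einv e) = einv (gmor_e e) }.

Definition star_map (G H : graph) (mu : graph_mor G H) (u : G) (f : star u) :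
    star (mu u) :=
  existT _ (mu (projT1 f)) (gmor_e mu (projT2 f)).

(* The edge groups of [e] and of its inverse are identified by the isomorphism
   [flip] rather than being the same type; [alpha_flip2] says that
   [flip (flip x)] is [x] up to the identity [einvK] (the two sides live over
   the edges [einv (einv e)] and [e], and [alpha] is injective). *)
Record gog := GoG {
  gog_graph :> graph;
  vgrp : gog_graph -> groupType;
  egrp : forall u v : gog_graph, edge u v -> groupType;
  flip : forall (u v : gog_graph) (e : edge u v),
    ghom (egrp e) (egrp (einv e));
  alpha : forall (u v : gog_graph) (e : edge u v), ghom (egrp e) (vgrp u);
  alpha_inj : forall (u v : gog_graph) (e : edge u v), injective (alpha e);
  alpha_flip2 : forall (u v : gog_graph) (e : edge u v) (x : egrp e),
    alpha (einv (einv e)) (flip (einv e) (flip e x)) = alpha e x }.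

Arguments vgrp : clear implicits.
Arguments egrp A {u v} e : rename.
Arguments flip {A u v} e : rename.
Arguments alpha {A u v} e : rename.

Definition omega (A : gog) (u v : A) (e : edge u v) (x : egrp A e) :
  vgrp A v := alpha (einv e) (flip e x).

Section Flip.
Variable A : gog.

Lemma omega_flip (u v : A) (e : edge u v) (x : egrp A e) :
  omega (flip e x) = alpha e x.
Proof. exact: alpha_flip2. Qed.

Lemma flip_surj (u v : A) (e : edge u v) (y : egrp A (einv e)) :
  exists x, flip e x = y.
Proof.
pose x := eq_rect _ (fun e0 => egrp A e0) (flip (einv e) y) _ (einvK e).
exists x; apply: (@alpha_inj A).
have := alpha_flip2 (flip (einv e) y); rewrite -[RHS]/(omega y) => E2.
suff S : forall e1 (E : e1 = e) (z : egrp A e1),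
    omega (eq_rect e1 (fun e0 => egrp A e0) z e E) = omega z.
  rewrite -[LHS]/(omega x) S -[LHS]/(alpha _ (flip _ _)).
  exact: alpha_flip2.
by move=> e1 E z; case: _ / E.
Qed.

Lemma omega_inj (u v : A) (e : edge u v) : injective (@omega A u v e).
Proof.
move=> x y /(@alpha_inj A) E; apply: (@alpha_inj A).
by rewrite -(alpha_flip2 x) -(alpha_flip2 y) E.
Qed.

End Flip.

Section Paths.
Variable A : gog.

(* A path is sorted by its end points; [pnil u a] is the path [(a)] of length
   0, and [pcons a e p] prefixes [a, e] to the sequence [p]. *)
Inductive gpath : A -> A -> Type :=
| pnil u (a : vgrp A u) : gpath u u
| pcons u v w (a : vgrp A u) (e : edge u v) (p : gpath v w) : gpath u w.

Definition lmulp u v (a : vgrp A u) (p : gpath u v) : gpath u v :=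
  match p in gpath u v return vgrp A u -> gpath u v with
  | pnil _ b => fun a => pnil (a * b)
  | pcons _ _ _ b e q => fun a => pcons (a * b) e q
  end a.

Fixpoint pcat u v w (p : gpath u v) : gpath v w -> gpath u w :=
  match p in gpath u v return gpath v w -> gpath u w with
  | pnil _ a => fun q => lmulp a q
  | pcons _ _ _ a e p => fun q => pcons a e (pcat p q)
  end.

Fixpoint pinv u v (p : gpath u v) : gpath v u :=
  match p in gpath u v return gpath v u with
  | pnil _ a => pnil a^-1
  | pcons _ _ _ a e p => pcat (pinv p) (pcons 1 (einv e) (pnil a^-1))
  end.

Inductive path_eq : forall u v, gpath u v -> gpath u v -> Prop :=
| path_eq_edge u v (e : edge u v) (x : egrp A e) :
    path_eq (pcons 1 e (pcons (omega x) (einv e) (pnil 1)))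
            (pnil (alpha e x))
| path_eq_refl u v (p : gpath u v) : path_eq p p
| path_eq_sym u v (p q : gpath u v) : path_eq p q -> path_eq q p
| path_eq_trans u v (p q r : gpath u v) :
    path_eq p q -> path_eq q r -> path_eq p r
| path_eq_cat u v w (p p' : gpath u v) (q q' : gpath v w) :
    path_eq p p' -> path_eq q q' -> path_eq (pcat p q) (pcat p' q').

Lemma lmulpM u v (a b : vgrp A u) (p : gpath u v) :
  lmulp a (lmulp b p) = lmulp (a * b) p.
Proof. by case: p a b => [w c|w w' w'' c e q] a b /=; rewrite mulgA. Qed.

Lemma lmul1p u v (p : gpath u v) : lmulp 1 p = p.
Proof. by case: p => [w c|w w' w'' c e q] /=; rewrite mul1g. Qed.

Lemma pcat_lmul u v w (a : vgrp A u) (p : gpath u v) (q : gpath v w) :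
  pcat (lmulp a p) q = lmulp a (pcat p q).
Proof. by case: p a q => [x c|x y z c e p] a q //=; rewrite lmulpM. Qed.

Lemma pcatA u v w x (p : gpath u v) (q : gpath v w) (r : gpath w x) :
  pcat p (pcat q r) = pcat (pcat p q) r.
Proof.
elim: p q => [y a|y y' y'' a e p IH] q /=; first by rewrite pcat_lmul.
by rewrite IH.
Qed.

Lemma pcatp1 u v (p : gpath u v) : pcat p (pnil 1) = p.
Proof. by elim: p => [y a|y y' y'' a e p /= ->] //=; rewrite mulg1. Qed.

Lemma pcat_cons1 u v w (a : vgrp A u) (e : edge u v) (p : gpath v w) :
  pcons a e p = pcat (pcons a e (pnil 1)) p.
Proof. by rewrite /= lmul1p. Qed.

Lemma pcatVp u v (p : gpath u v) : path_eq (pcat (pinv p) p) (pnil 1).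
Proof.
elim: p => [x a|x y z a e p IH] /=.
  by rewrite mulVg; apply: path_eq_refl.
rewrite -pcatA /= mulVg.
have -> : pcons 1 (einv e) (pcons 1 e p) =
    pcat (pcons 1 (einv e) (pcons 1 e (pnil 1))) p by rewrite /= lmul1p.
apply: path_eq_trans IH; apply: path_eq_cat; first exact: path_eq_refl.
rewrite -[X in path_eq _ X]lmul1p -[lmulp 1 p]/(pcat (pnil 1) p).
apply: path_eq_cat; last exact: path_eq_refl.
have := path_eq_edge (1 : egrp A (einv e)).
by rewrite /omega !gmulf1 einvK.
Qed.

Lemma pinv_cat u v w (p : gpath u v) (q : gpath v w) :
  pinv (pcat p q) = pcat (pinv q) (pinv p).
Proof.
have L x y (a : vgrp A x) (r : gpath x y) :
    pinv (lmulp a r) = pcat (pinv r) (pnil a^-1).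
  case: r a => [t b|t t' t'' b e r] a /=; rewrite invgM //.
  by rewrite -pcatA /=.
elim: p q => [x a|x y z a e p IH] q /=; first by rewrite L.
by rewrite IH pcatA.
Qed.

Lemma pinvK u v (p : gpath u v) : pinv (pinv p) = p.
Proof.
elim: p => [x a|x y z a e p IH] /=; first by rewrite invgK.
by rewrite pinv_cat /= IH !invgK einvK invg1 mulg1 lmul1p.
Qed.

Lemma path_eq_inv u v (p q : gpath u v) :
  path_eq p q -> path_eq (pinv p) (pinv q).
Proof.
move=> pq.
have H1 : path_eq (pcat (pinv p) (pcat q (pinv q))) (pinv p).
  rewrite -[X in path_eq _ X]pcatp1; apply: path_eq_cat.
    exact: path_eq_refl.
  by rewrite -{1}[q]pinvK; apply: pcatVp.
apply: path_eq_trans (path_eq_sym H1) _; rewrite pcatA.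
rewrite -[X in path_eq _ X]lmul1p -[lmulp 1 _]/(pcat (pnil 1) (pinv q)).
apply: path_eq_cat; last exact: path_eq_refl.
apply: path_eq_trans (pcatVp p).
apply: path_eq_cat; first exact: path_eq_refl.
exact: path_eq_sym.
Qed.

HB.instance Definition _ u v := gen_eqMixin (gpath u v).
HB.instance Definition _ u v := gen_choiceMixin (gpath u v).

Definition path_eqb u v : rel (gpath u v) := fun p q => `[< path_eq p q >].

Lemma path_eqb_refl u v : reflexive (@path_eqb u v).
Proof. by move=> p; apply/asboolP; apply: path_eq_refl. Qed.

Lemma path_eqb_sym u v : symmetric (@path_eqb u v).
Proof. by move=> p q; apply/asboolP/asboolP; apply: path_eq_sym. Qed.

Lemma path_eqb_trans u v : transitive (@path_eqb u v).
Proof.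
by move=> q p r /asboolP pq /asboolP qr; apply/asboolP; apply: path_eq_trans qr.
Qed.

Canonical path_eq_equiv u v :=
  EquivRel (@path_eqb u v) (@path_eqb_refl u v) (@path_eqb_sym u v)
    (@path_eqb_trans u v).

(* The morphisms from [u] to [v] in the fundamental groupoid. *)
Definition pi_hom u v := {eq_quot (path_eq_equiv u v)}.

HB.instance Definition _ u v := Choice.on (pi_hom u v).

Definition pclass u v (p : gpath u v) : pi_hom u v := \pi_(pi_hom u v) p.

Lemma pclassE u v (p q : gpath u v) : pclass p = pclass q <-> path_eq p q.
Proof.
split=> [/eqmodP /asboolP //|pq].
by apply/eqmodP/asboolP.
Qed.

Lemma pclass_repr u v (x : pi_hom u v) : pclass (repr x) = x.
Proof. exact: reprK. Qed.

Lemma repr_pclass u v (p : gpath u v) : path_eq (repr (pclass p)) p.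
Proof. by apply/pclassE; rewrite pclass_repr. Qed.

Definition pi_mul u v w (x : pi_hom u v) (y : pi_hom v w) : pi_hom u w :=
  pclass (pcat (repr x) (repr y)).

Definition pi_inv u v (x : pi_hom u v) : pi_hom v u := pclass (pinv (repr x)).

Definition pi1 u := pi_hom u u.

HB.instance Definition _ u := Choice.on (pi1 u).

Lemma pi_mulE u v w (p : gpath u v) (q : gpath v w) :
  pi_mul (pclass p) (pclass q) = pclass (pcat p q).
Proof. by apply/pclassE/path_eq_cat; apply: repr_pclass. Qed.

Lemma pi_invE u v (p : gpath u v) : pi_inv (pclass p) = pclass (pinv p).
Proof. by apply/pclassE/path_eq_inv/repr_pclass. Qed.

Lemma pi1_mulA u : associative (@pi_mul u u u).
Proof.
move=> x y z; rewrite -[x]pclass_repr -[y]pclass_repr -[z]pclass_repr.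
by rewrite !pi_mulE pcatA.
Qed.

Lemma pi1_mul1 u : left_id (pclass (@pnil u 1)) (@pi_mul u u u).
Proof. by move=> x; rewrite -[x]pclass_repr pi_mulE /= lmul1p. Qed.

Lemma pi1_mulr1 u : right_id (pclass (@pnil u 1)) (@pi_mul u u u).
Proof. by move=> x; rewrite -[x]pclass_repr pi_mulE pcatp1. Qed.

Lemma pi1_mulV u :
  left_inverse (pclass (@pnil u 1)) (@pi_inv u u) (@pi_mul u u u).
Proof.
move=> x; rewrite -[x]pclass_repr pi_invE pi_mulE.
exact/pclassE/pcatVp.
Qed.

Lemma pi1_mulrV u :
  right_inverse (pclass (@pnil u 1)) (@pi_inv u u) (@pi_mul u u u).
Proof.
move=> x; rewrite -[x]pclass_repr pi_invE pi_mulE.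
by apply/pclassE; rewrite -{1}[repr x]pinvK; apply: pcatVp.
Qed.

HB.instance Definition _ u :=
  isGroup.Build (pi1 u) (@pi1_mulA u) (@pi1_mul1 u) (@pi1_mulr1 u)
    (@pi1_mulV u) (@pi1_mulrV u).

Lemma pi1_mulE u (p q : gpath u u) :
  (pclass p : pi1 u) * pclass q = pclass (pcat p q).
Proof. exact: pi_mulE. Qed.

Lemma pi1_oneE u : (1 : pi1 u) = pclass (pnil 1).
Proof. by []. Qed.

End Paths.

Arguments pnil {A} u a : rename.

(* The compatibility of the edge homomorphisms with [flip] need not be required:
   it follows from [gm_alpha] and [gm_omega], see [emap_at_flip]. *)
Record gog_mor (B A : gog) := GogMor {
  gm_graph :> graph_mor B A;
  gm_v : forall v : B, ghom (vgrp B v) (vgrp A (gm_graph v));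
  gm_e : forall (v v' : B) (f : edge v v'),
    ghom (egrp B f) (egrp A (gmor_e gm_graph f));
  gm_v_inj : forall v : B, injective (gm_v v);
  gm_e_inj : forall (v v' : B) (f : edge v v'), injective (gm_e f);
  tw_alpha : forall v v' : B, edge v v' -> vgrp A (gm_graph v);
  tw_omega : forall v v' : B, edge v v' -> vgrp A (gm_graph v');
  tw_alpha_inv : forall (v v' : B) (f : edge v v'),
    tw_alpha (einv f) = tw_omega f;
  tw_omega_inv : forall (v v' : B) (f : edge v v'),
    tw_omega (einv f) = tw_alpha f;
  gm_alpha : forall (v v' : B) (f : edge v v') (x : egrp B f),
    alpha (gmor_e gm_graph f) (gm_e f x) = gm_v v (alpha f x) ^ tw_alpha f;
  gm_omega : forall (v v' : B) (f : edge v v') (x : egrp B f),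
    omega (gm_e f x) = gm_v v' (omega x) ^ tw_omega f }.

Section MorphismPaths.
Variables (B A : gog) (mu : gog_mor B A).

Fixpoint mor_path v w (p : gpath v w) : gpath (mu v) (mu w) :=
  match p in gpath v w return gpath (mu v) (mu w) with
  | pnil v b => pnil (mu v) (gm_v mu v b)
  | pcons _ _ _ b f q =>
      pcons (gm_v mu _ b * tw_alpha mu f) (gmor_e mu f)
        (lmulp (tw_omega mu f)^-1 (mor_path q))
  end.

Lemma mor_path_lmul v w (b : vgrp B v) (p : gpath v w) :
  mor_path (lmulp b p) = lmulp (gm_v mu v b) (mor_path p).
Proof. by case: p b => [x c|x y z c e p] b /=; rewrite gmulfM ?mulgA. Qed.

Lemma mor_path_cat u v w (p : gpath u v) (q : gpath v w) :
  mor_path (pcat p q) = pcat (mor_path p) (mor_path q).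
Proof.
elim: p q => [x b|x y z b f p IH] q /=; first by rewrite mor_path_lmul.
by rewrite IH pcat_lmul.
Qed.

Lemma mor_path_eq v w (p q : gpath v w) :
  path_eq p q -> path_eq (mor_path p) (mor_path q).
Proof.
elim=> {v w p q} [v w f x|v w p|v w p q _ IH|v w p q r _ IH1 _ IH2
                 |u v w p p' q q' _ IHp _ IHq].
- rewrite /= !gmulf1 mul1g mulg1 tw_alpha_inv tw_omega_inv gmor_inv.
  have -> : (tw_omega mu f)^-1 * (gm_v mu w (omega x) * tw_omega mu f)
      = omega (gm_e mu f x) by rewrite gm_omega conjgE.
  have := path_eq_cat (path_eq_cat (path_eq_refl (pnil _ (tw_alpha mu f)))
     (path_eq_edge (gm_e mu f x))) (path_eq_refl (pnil _ (tw_alpha mu f)^-1)).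
  by rewrite /= mulg1 mul1g gm_alpha conjgE !mulgA mulgV mul1g mulgK.
- exact: path_eq_refl.
- exact: path_eq_sym.
- exact: path_eq_trans IH1 IH2.
- by rewrite !mor_path_cat; apply: path_eq_cat.
Qed.

Definition pi1_map v (x : pi1 v) : pi1 (mu v) := pclass (mor_path (repr x)).

Lemma pi1_mapE v (p : gpath v v) :
  pi1_map (pclass p) = pclass (mor_path p).
Proof. by apply/pclassE/mor_path_eq/repr_pclass. Qed.

Definition immersion :=
  (forall (v : B) (f f' : star v) (e : star (mu v)),
     star_map mu f = e -> star_map mu f' = e ->
     (f = f' <->
      dcoset (range (gm_v mu v)) (range (alpha (projT2 e)))
             (tw_alpha mu (projT2 f)) =
      dcoset (range (gm_v mu v)) (range (alpha (projT2 e)))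
             (tw_alpha mu (projT2 f')))) /\
  (forall (v v' : B) (f : edge v v'),
     alpha (gmor_e mu f) @` range (gm_e mu f) =
     conj_set (range (gm_v mu v)) (tw_alpha mu f)
       `&` range (alpha (gmor_e mu f))).

(* The disjoint union over [e \in Star(mu v)] of the double coset spaces is a
   set of pairs [(e, X)]. *)
Definition covering :=
  immersion /\
  forall v : B,
    set_bij [set: star v]
      [set eX : star (mu v) * set (vgrp A (mu v)) |
         exists a, eX.2 = dcoset (range (gm_v mu v))
                                 (range (alpha (projT2 eX.1))) a]
      (fun f => (star_map mu f,
                 dcoset (range (gm_v mu v))
                        (range (alpha (projT2 (star_map mu f))))
                        (tw_alpha mu (projT2 f)))).

End MorphismPaths.

(* An equation [mu v = u] between vertices moves elements and paths between the
   corresponding fibres. *)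
Definition vcast (A : gog) (u u' : A) (h : u = u') (a : vgrp A u) : vgrp A u' :=
  eq_rect u (vgrp A) a u' h.

Definition pcast (A : gog) (u u' w w' : A) (h : u = u') (k : w = w')
    (p : gpath u w) : gpath u' w' :=
  eq_rect w (gpath u') (eq_rect u (fun x => gpath x w) p u' h) w' k.

Section MorphismAt.
Variables (B A : gog) (mu : gog_mor B A).

Definition pi1_image (v : B) (u : A) (h : mu v = u) : set (pi1 u) :=
  match h in _ = u return set (pi1 u) with
  | erefl => range (@pi1_map B A mu v)
  end.

Definition vmap_at (v : B) (u : A) (h : mu v = u) :
    ghom (vgrp B v) (vgrp A u) :=
  match h in _ = u return ghom (vgrp B v) (vgrp A u) with
  | erefl => gm_v mu v
  end.

(* [over_edge f e] means that [mu] maps [f] to [e]; this is a relation because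
   the end points of [mu f] and [e] agree only propositionally. *)
Inductive over_edge (v v' : B) (f : edge v v') :
    forall u u' : A, edge u u' -> Prop :=
| Over_edge : over_edge f (gmor_e mu f).

Definition emap_at (v v' : B) (f : edge v v') (u u' : A) (e : edge u u')
    (h : over_edge f e) : ghom (egrp B f) (egrp A e) :=
  match h in @over_edge _ _ _ u u' e return ghom (egrp B f) (egrp A e) with
  | Over_edge => gm_e mu f
  end.

Lemma over_edge_inv (v v' : B) (f : edge v v') (u u' : A) (e : edge u u') :
  over_edge f e -> over_edge (einv f) (einv e).
Proof. by case; rewrite -gmor_inv. Qed.

Lemma emap_at_alpha (v v' : B) (f : edge v v') (u u' : A) (e : edge u u')
    (hf : over_edge f e) (h : mu v = u) (x : egrp B f) :
  alpha e (emap_at hf x) = vmap_at h (alpha f x) ^ vcast h (tw_alpha mu f).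
Proof.
case: _ _ _ / hf h => h; rewrite (Prop_irrelevance h erefl) /=.
exact: gm_alpha.
Qed.

Lemma emap_at_omega (v v' : B) (f : edge v v') (u u' : A) (e : edge u u')
    (hf : over_edge f e) (h : mu v' = u') (x : egrp B f) :
  omega (emap_at hf x) = vmap_at h (omega x) ^ vcast h (tw_omega mu f).
Proof.
case: _ _ _ / hf h => h; rewrite (Prop_irrelevance h erefl) /=.
exact: gm_omega.
Qed.

Lemma over_edge_target (v v' : B) (f : edge v v') (u u' : A) (e : edge u u') :
  over_edge f e -> mu v' = u'.
Proof. by case. Qed.

Lemma emap_at_flip (v v' : B) (f : edge v v') (u u' : A) (e : edge u u')
    (hf : over_edge f e) (hf' : over_edge (einv f) (einv e)) (x : egrp B f) :
  emap_at hf' (flip f x) = flip e (emap_at hf x).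
Proof.
apply: (@alpha_inj A); rewrite -[RHS]/(omega _).
have h := over_edge_target hf.
by rewrite (emap_at_alpha hf' h) (emap_at_omega hf h) tw_alpha_inv.
Qed.

End MorphismAt.

Arguments pi1_image {B A} mu {v u} h.

Section Product.
Variables (A B C : gog) (muB : gog_mor B A) (muC : gog_mor C A).

(* [pv_u] is the common image of [pv_v] and [pv_w], hence redundant, and so is
   [pe_e] below; having them as separate fields keeps the double cosets in
   groups that do not single out one of the two factors. *)
Record pvertex := PVertex {
  pv_u : A;
  pv_v : B;
  pv_w : C;
  pv_hv : muB pv_v = pv_u;
  pv_hw : muC pv_w = pv_u;
  pv_set : set (vgrp A pv_u);
  pv_setP : exists a,
    pv_set = dcoset (range (vmap_at pv_hv)) (range (vmap_at pv_hw)) a }.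

Arguments pv_set p : clear implicits.

Section EdgeData.
Variables (x y : pvertex).
Variables (e : edge (pv_u x) (pv_u y)) (f : edge (pv_v x) (pv_v y))
  (g : edge (pv_w x) (pv_w y)).

Definition origin_coset (a : egrp A e) : set (vgrp A (pv_u x)) :=
  dcoset (range (vmap_at (pv_hv x))) (range (vmap_at (pv_hw x)))
    (vcast (pv_hv x) (tw_alpha muB f) * alpha e a *
     (vcast (pv_hw x) (tw_alpha muC g))^-1).

Definition terminus_coset (a : egrp A e) : set (vgrp A (pv_u y)) :=
  dcoset (range (vmap_at (pv_hv y))) (range (vmap_at (pv_hw y)))
    (vcast (pv_hv y) (tw_omega muB f) * omega a *
     (vcast (pv_hw y) (tw_omega muC g))^-1).

End EdgeData.

(* [pe_set] is non-empty, and the two cosets do not depend on the choice of its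
   element [a]. *)
Record pedge (x y : pvertex) := PEdge {
  pe_e : edge (pv_u x) (pv_u y);
  pe_f : edge (pv_v x) (pv_v y);
  pe_g : edge (pv_w x) (pv_w y);
  pe_hf : over_edge muB pe_f pe_e;
  pe_hg : over_edge muC pe_g pe_e;
  pe_set : set (egrp A pe_e);
  pe_setP : exists a,
    pe_set = dcoset (range (emap_at pe_hf)) (range (emap_at pe_hg)) a;
  pe_origin : forall a, pe_set a -> pv_set x = origin_coset pe_f pe_g a;
  pe_terminus : forall a, pe_set a -> pv_set y = terminus_coset pe_f pe_g a }.

Arguments pe_set {x y} p.

Lemma pedge_inv_setP x y (h : pedge x y) : exists a,
  flip (pe_e h) @` pe_set h =
  dcoset (range (emap_at (over_edge_inv (pe_hf h))))
         (range (emap_at (over_edge_inv (pe_hg h)))) a.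
Proof.
have [a ->] := pe_setP h; exists (flip (pe_e h) a); apply/seteqP; split.
- move=> _ [_ [_ [_ [[b _ <-] [c _ <-] ->]]] <-].
  exists (flip _ (emap_at (pe_hf h) b)), (flip _ (emap_at (pe_hg h) c)).
  split; last by rewrite !gmulfM.
  + by exists (flip _ b) => //; apply: emap_at_flip.
  + by exists (flip _ c) => //; apply: emap_at_flip.
- move=> _ [_ [_ [[b' _ <-] [c' _ <-] ->]]].
  have [b <-] := flip_surj b'; have [c <-] := flip_surj c'.
  exists (emap_at (pe_hf h) b * a * emap_at (pe_hg h) c).
    by exists (emap_at (pe_hf h) b), (emap_at (pe_hg h) c).
  by rewrite !gmulfM (emap_at_flip (pe_hf h)) (emap_at_flip (pe_hg h)).
Qed.

Lemma pedge_inv_origin x y (h : pedge x y) (a : egrp A (einv (pe_e h))) :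
  (flip (pe_e h) @` pe_set h) a ->
  pv_set y = origin_coset (einv (pe_f h)) (einv (pe_g h)) a.
Proof.
case=> b hb <-; rewrite (pe_terminus hb) /origin_coset /terminus_coset.
by rewrite !tw_alpha_inv.
Qed.

Lemma pedge_inv_terminus x y (h : pedge x y) (a : egrp A (einv (pe_e h))) :
  (flip (pe_e h) @` pe_set h) a ->
  pv_set x = terminus_coset (einv (pe_f h)) (einv (pe_g h)) a.
Proof.
case=> b hb <-; rewrite (pe_origin hb) /origin_coset /terminus_coset.
by rewrite !tw_omega_inv omega_flip.
Qed.

Definition pedge_inv x y (h : pedge x y) : pedge y x :=
  @PEdge y x (einv (pe_e h)) (einv (pe_f h)) (einv (pe_g h))
    (over_edge_inv (pe_hf h)) (over_edge_inv (pe_hg h))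
    (flip (pe_e h) @` pe_set h)
    (pedge_inv_setP h) (@pedge_inv_origin x y h) (@pedge_inv_terminus x y h).

Lemma pedge_eq x y (h h' : pedge x y) :
  existT (fun e => set (egrp A e)) (pe_e h) (pe_set h) =
    existT (fun e => set (egrp A e)) (pe_e h') (pe_set h') ->
  pe_f h = pe_f h' -> pe_g h = pe_g h' -> h = h'.
Proof.
have P (T : Type) (F : T -> Type) (s t : {z : T & F z}) : s = t ->
    exists E : projT1 s = projT1 t, eq_rect _ F (projT2 s) _ E = projT2 t.
  by move=> ->; exists erefl.
case: h => e f g hf hg X hX ho ht; case: h' => e' f' g' hf' hg' X' hX' ho' ht'.
move=> /= /P /= [E EX] Ef Eg.
case: e' / E hf' hg' X' EX hX' ho' ht' => hf' hg' X' EX hX' ho' ht'.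
move: Ef Eg EX => /= Ef Eg EX; subst f' g' X'.
have E1 := Prop_irrelevance hf hf'; subst hf'.
have E2 := Prop_irrelevance hg hg'; subst hg'.
by rewrite (Prop_irrelevance hX hX') (Prop_irrelevance ho ho')
  (Prop_irrelevance ht ht').
Qed.

Lemma pedge_invK x y (h : pedge x y) : pedge_inv (pedge_inv h) = h.
Proof.
apply: pedge_eq => /=; [|exact: einvK|exact: einvK].
have H (e' : edge (pv_u x) (pv_u y)) (phi : egrp A (pe_e h) -> egrp A e') :
    e' = pe_e h -> (forall a, alpha e' (phi a) = alpha (pe_e h) a) ->
    existT (fun e => set (egrp A e)) e' (phi @` pe_set h) =
    existT (fun e => set (egrp A e)) (pe_e h) (pe_set h).
  move=> E'; case: (pe_e h) / E' phi (pe_set h) => phi X hphi.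
  suff -> : phi = id by rewrite image_id.
  by apply: funext => a; apply: (@alpha_inj A).
rewrite image_comp; apply: H => [|a]; [exact: einvK|exact: alpha_flip2].
Qed.

Lemma pedge_inv_neq x (h : pedge x x) : pedge_inv h <> h.
Proof. by move=> /(congr1 (@pe_f x x)) /= /einv_neq. Qed.

Definition pgraph : graph :=
  @Graph pvertex pedge pedge_inv pedge_invK pedge_inv_neq.

(* The choices made in the construction of the product; [erep_inv] is the
   requirement that an edge and its inverse have the same representative. *)
Record product_reps := ProductReps {
  vrep : forall x : pvertex, vgrp A (pv_u x);
  vrepP : forall x, pv_set x (vrep x);
  erep : forall x y (h : pedge x y), egrp A (pe_e h);
  erepP : forall x y (h : pedge x y), pe_set h (erep h);
  erep_inv : forall x y (h : pedge x y),
    erep (pedge_inv h) = flip (pe_e h) (erep h);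
  rep_b : forall x y (h : pedge x y), vgrp B (pv_v x);
  rep_c : forall x y (h : pedge x y), vgrp C (pv_w x);
  rep_eq : forall x y (h : pedge x y),
    vrep x =
      vmap_at (pv_hv x) (rep_b h) * vcast (pv_hv x) (tw_alpha muB (pe_f h)) *
      alpha (pe_e h) (erep h) *
      (vcast (pv_hw x) (tw_alpha muC (pe_g h)))^-1 *
      (vmap_at (pv_hw x) (rep_c h))^-1 }.

Lemma product_reps_exist : inhabited product_reps.
Proof.
have [o ho] := orientation_exists pgraph.
have vP (x : pvertex) : exists a, pv_set x a.
  have [a ->] := pv_setP x; exists a, 1, 1.
  split; last by rewrite mul1g mulg1.
    by exists 1; rewrite // gmulf1.
  by exists 1; rewrite // gmulf1.
have eP (x y : pvertex) (h : pedge x y) : exists a, pe_set h a.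
  have [a ->] := pe_setP h; exists a, 1, 1.
  split; last by rewrite mul1g mulg1.
    by exists 1; rewrite // gmulf1.
  by exists 1; rewrite // gmulf1.
pose vr x := sval (cid (vP x)).
pose er0 x y h := sval (cid (@eP x y h)).
pose er x y (h : pedge x y) : egrp A (pe_e h) :=
  if o x y h then er0 x y h
  else sval (cid (flip_surj (er0 y x (pedge_inv h)))).
have fl2 x y (h : pedge x y) :
    flip (pe_e (pedge_inv h)) (flip (pe_e h) (er0 x y h)) =
    er0 x y (pedge_inv (pedge_inv h)).
  apply: (@alpha_inj A); rewrite alpha_flip2.
  have K h' : h' = h ->
      alpha (pe_e h) (er0 x y h) = alpha (pe_e h') (er0 x y h').
    by move=> ->.
  exact: K (pedge_invK h).
have flip_inj (u v : A) (e : edge u v) : injective (flip e).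
  by move=> a b E; apply: omega_inj; rewrite /omega E.
have erI x y (h : pedge x y) : er y x (pedge_inv h) = flip (pe_e h) (er x y h).
  rewrite /er (ho x y h); case: (o x y h) => /=; case: cid => z /= Hz //.
  by apply: flip_inj; rewrite Hz fl2.
have erP x y (h : pedge x y) : pe_set h (er x y h).
  rewrite /er; case: (o x y h); first exact: svalP.
  case: cid => z /= Hz.
  have := svalP (cid (eP _ _ (pedge_inv h))).
  rewrite -[sval _]/(er0 _ _ _) -Hz.
  case=> z' hz' E; suff <- : z' = z by [].
  by apply: omega_inj; rewrite /omega E.
have bc x y (h : pedge x y) : exists bc : vgrp B (pv_v x) * vgrp C (pv_w x),
   vr x = vmap_at (pv_hv x) bc.1 * vcast (pv_hv x) (tw_alpha muB (pe_f h)) *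
      alpha (pe_e h) (er x y h) *
      (vcast (pv_hw x) (tw_alpha muC (pe_g h)))^-1 *
      (vmap_at (pv_hw x) bc.2)^-1.
  have := svalP (cid (vP x)); rewrite -[sval _]/(vr x) (pe_origin (erP _ _ h)).
  move=> [_ [_ [[b _ <-] [c _ <-] ->]]]; exists (b, c^-1) => /=.
  by rewrite gmulfV invgK !mulgA.
constructor; apply: (@ProductReps vr _ er erP erI
   (fun x y h => (sval (cid (bc x y h))).1)
   (fun x y h => (sval (cid (bc x y h))).2)).
- by move=> x; exact: (svalP (cid (vP x))).
- by move=> x y h; exact: (svalP (cid (bc x y h))).
Qed.

Variable r : product_reps.

Definition pvgrp (x : pvertex) : groupType :=
  pullback (vmap_at (pv_hv x)) (vmap_at (pv_hw x)) (vrep r x).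

Definition pegrp x y (h : pedge x y) : groupType :=
  pullback (emap_at (pe_hf h)) (emap_at (pe_hg h)) (erep r h).

Section ProductMaps.
Variables (x y : pvertex) (h : pedge x y).

Lemma palpha_subproof (z : pegrp h) :
  pullback_pred (vmap_at (pv_hv x)) (vmap_at (pv_hw x)) (vrep r x)
    (rep_b r h * alpha (pe_f h) (val z).1 * (rep_b r h)^-1,
     rep_c r h * alpha (pe_g h) (val z).2 * (rep_c r h)^-1).
Proof.
case: z => [[b c] /= /eqP /= hbc]; apply/eqP => /=.
have J (G : groupType) (s t : G) : s * t * s^-1 = t ^ s^-1.
  by rewrite conjgE invgK mulgA.
rewrite !J; set s := rep_b r h; set t := rep_c r h.
have morphJ (G H : groupType) (phi : ghom G H) (a k : G) :
    phi (a ^ k) = phi a ^ phi k by rewrite !conjgE !gmulfM gmulfV.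
rewrite !morphJ !gmulfV (rep_eq r h) -/s -/t !conjgM conjgKV.
rewrite -(emap_at_alpha (pe_hf h)) -morphJ hbc.
by rewrite (emap_at_alpha _ (pv_hw x)) conjgK.
Qed.

Definition palpha_fun (z : pegrp h) : pvgrp x := Pullback (palpha_subproof z).

Lemma palpha_morph : {morph palpha_fun : z1 z2 / z1 / z2}.
Proof.
have J (G : groupType) (s t : G) : s * t * s^-1 = t ^ s^-1.
  by rewrite conjgE invgK mulgA.
move=> z1 z2; apply: val_inj; rewrite gmulfM gmulfV /= !J.
by rewrite !gmulfM !gmulfV !conjMg !conjVg.
Qed.

HB.instance Definition _ :=
  isGroupMorphism.Build (pegrp h) (pvgrp x) palpha_fun palpha_morph.

Definition palpha : ghom (pegrp h) (pvgrp x) := palpha_fun.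

Lemma palpha_inj : injective palpha.
Proof.
move=> z1 z2 /(congr1 val) [] /mulIg /mulgI /alpha_inj E1.
move=> /mulIg /mulgI /alpha_inj E2.
by apply: val_inj; rewrite [LHS]surjective_pairing E1 E2 -surjective_pairing.
Qed.

Lemma pflip_subproof (z : pegrp h) :
  pullback_pred (emap_at (pe_hf (pedge_inv h))) (emap_at (pe_hg (pedge_inv h)))
    (erep r (pedge_inv h)) (flip (pe_f h) (val z).1, flip (pe_g h) (val z).2).
Proof.
case: z => [[b c] /= /eqP /= hbc]; apply/eqP => /=.
have morphJ (G H : groupType) (phi : ghom G H) (a k : G) :
    phi (a ^ k) = phi a ^ phi k by rewrite !conjgE !gmulfM gmulfV.
rewrite erep_inv (emap_at_flip (pe_hf h)) (emap_at_flip (pe_hg h)).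
by rewrite -morphJ hbc.
Qed.

Definition pflip_fun (z : pegrp h) : pegrp (pedge_inv h) :=
  Pullback (pflip_subproof z).

Lemma pflip_morph : {morph pflip_fun : z1 z2 / z1 / z2}.
Proof.
move=> z1 z2; apply: val_inj; rewrite gmulfM gmulfV /=.
by rewrite !gmulfM !gmulfV.
Qed.

HB.instance Definition _ :=
  isGroupMorphism.Build (pegrp h) (pegrp (pedge_inv h)) pflip_fun pflip_morph.

Definition pflip : ghom (pegrp h) (pegrp (pedge_inv h)) := pflip_fun.

End ProductMaps.

Lemma palpha_flip2 (x y : pvertex) (h : pedge x y) (z : pegrp h) :
  palpha (pedge_inv (pedge_inv h)) (pflip (pedge_inv h) (pflip h z)) =
  palpha h z.
Proof.
by apply: val_inj; rewrite /= !alpha_flip2 pedge_invK.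
Qed.

Definition gog_product : gog :=
  @GoG pgraph pvgrp pegrp pflip palpha palpha_inj palpha_flip2.

End Product.

Arguments pv_set {A B C muB muC} p.
Arguments pe_set {A B C muB muC x y} p.

Section Subgraph.
Variables (A : gog) (P : set A).

Lemma full_einvK (u v : {u : A | P u}) (e : edge (sval u) (sval v)) :
  einv (einv e) = e.
Proof. exact: einvK. Qed.

Lemma full_einv_neq (u : {u : A | P u}) (e : edge (sval u) (sval u)) :
  einv e <> e.
Proof. exact: einv_neq. Qed.

Definition full_graph : graph :=
  @Graph {u : A | P u} (fun u v => edge (sval u) (sval v))
    (fun u v e => einv e) full_einvK full_einv_neq.

(* The restriction of [A] to the full subgraph on the vertices in [P]; when [P]
   is a union of connected components this is that union. *)
Definition full_gog : gog :=
  @GoG full_graph (fun u => vgrp A (sval u)) (fun u v e => egrp A e)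
    (fun u v e => flip e) (fun u v e => alpha e)
    (fun u v e => @alpha_inj A _ _ e) (fun u v e => @alpha_flip2 A _ _ e).

End Subgraph.

(* For connected [A] the choice of the base vertex is immaterial. *)
Definition nontrivial_pi1 (A : gog) := exists (u : A) (g : pi1 u), g <> 1.

Definition nontrivial_part (A : gog) : gog :=
  full_gog [set u : A | nontrivial_pi1 (full_gog (component u))].

Section DoubleCosetMap.
Variables (A B C : gog) (muB : gog_mor B A) (muC : gog_mor C A).
Variables (u0 : A) (v0 : B) (w0 : C).
Variables (hv0 : muB v0 = u0) (hw0 : muC w0 = u0).
Variables (p : forall v : B, gpath v0 v) (q : forall w : C, gpath w0 w).

Definition vertex_loop (x : pvertex muB muC) (a : vgrp A (pv_u x)) :
    gpath u0 u0 :=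
  pcat (pcat (pcast hv0 (pv_hv x) (mor_path muB (p (pv_v x))))
             (pnil (pv_u x) a))
       (pinv (pcast hw0 (pv_hw x) (mor_path muC (q (pv_w x))))).

End DoubleCosetMap.

Arguments vertex_loop {A B C muB muC u0 v0 w0} hv0 hw0 p q x a.

(* Main.v *)
Require Import Defs.
From HB Require Import structures.
From mathcomp Require Import all_boot.
From mathcomp Require Import boolp classical_sets functions.

(** The proof takes place in fundamental groupoids.  A morphism [mu] of graphs
    of groups is used through two local conditions: [locally_injective], which
    every immersion satisfies, and [locally_surjective], which coverings satisfy
    in addition.

    The first condition becomes global through the normal form theorem: two
    reduced paths that are equal in the groupoid differ only by sliding edge
    group elements along their edges ([reduced_path_eq]).  This is proved by
    letting paths act on reduced paths, modulo slides.  A locally injective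
    morphism maps reduced paths to reduced paths ([reduced_mor_path]), so that a
    path whose image is a vertex group element has length 0
    ([pi_map_eq_vertex]), and the induced functor is faithful ([pi_map_inj]).
    The second condition gives lifts of paths ([path_lifting]).

    The product [E] of [B] and [C] over [A] has projections to [B] and to [C].
    If [x~] denotes the chosen representative of the double coset of a vertex
    [x], then every path [s] of [E] from [x] to [y] satisfies
        muB (proj_l s) * y~ = x~ * muC (proj_r s)
    ([product_square]).  Since [B -> A] is a covering, [E -> C] is locally
    injective and locally surjective, as expected of a pullback.  Conversely, if
    paths of [B] and of [C] satisfy the equation above, then the path of [C] is
    the projection of a path of [E] from [x] to [y] ([product_path]): it lifts
    to [E], and the other projection of the lift differs from the given path of
    [B] by a path whose image is a vertex group element, hence by a path of
    length 0.

    The theorem follows.  The double cosets attached to [x] and [y] agree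
    exactly when paths of [B] and [C] satisfying the equation exist
    ([dcoset_loop_class]), that is, when [x] and [y] are in the same component.
    For a circuit [s] at [x] the equation says that [x~] conjugates
    [muB (proj_l s)] to [muC (proj_r s)], so the circuits at [x] provide the
    elements of the intersection of [B^g] and [C]; nontrivial circuits give
    nontrivial elements because [E -> C] and [C -> A] induce faithful functors.
    Finally, lifting [g] to [B] shows that every double coset is attached to a
    vertex of [E]. *)

Set Implicit Arguments.
Unset Strict Implicit.
Unset Printing Implicit Defensive.

Local Open Scope classical_set_scope.
Local Open Scope group_scope.

Arguments gm_v {B A} g v.
Arguments gm_e {B A} g {v v'} f.
Arguments pcons {A u v w} a e p.

(** * Dependent pairs and double cosets of subgroups *)

Lemma existT_eq (T : Type) (P : T -> Type) (s t : {x : T & P x}) :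
  s = t ->
  exists E : projT1 s = projT1 t, eq_rect _ P (projT2 s) _ E = projT2 t.
Proof. by move=> ->; exists erefl. Qed.

Lemma existT_inj (T : Type) (P : T -> Type) (x : T) (a b : P x) :
  existT P x a = existT P x b -> a = b.
Proof. by case/existT_eq => /= E; rewrite (Prop_irrelevance E erefl). Qed.

Lemma dcosetP (G : groupType) (H K : set G) (g x : G) :
    (forall a b, H a -> H b -> H (a * b)) -> (forall a, H a -> H a^-1) ->
    (forall a b, K a -> K b -> K (a * b)) -> (forall a, K a -> K a^-1) ->
  dcoset H K g x -> dcoset H K g = dcoset H K x.
Proof.
move=> HM HV KM KV [h [k [Hh Kk ->]]]; apply/seteqP; split=> y.
  move=> [h' [k' [Hh' Kk' ->]]]; exists (h' * h^-1), (k^-1 * k').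
  split; [by apply: HM => //; exact: HV|by apply: KM => //; exact: KV|].
  by rewrite !mulgA mulgVK mulgK.
move=> [h' [k' [Hh' Kk' ->]]]; exists (h' * h), (k * k').
by split; [exact: HM|exact: KM|rewrite !mulgA].
Qed.

Lemma rangeM (G H : groupType) (phi : ghom G H) a b :
  range phi a -> range phi b -> range phi (a * b).
Proof. by move=> [x _ <-] [y _ <-]; exists (x * y); rewrite ?gmulfM. Qed.

Lemma rangeV (G H : groupType) (phi : ghom G H) a :
  range phi a -> range phi a^-1.
Proof. by move=> [x _ <-]; exists x^-1; rewrite ?gmulfV. Qed.

Lemma dcoset_range (G H K : groupType) (phi : ghom G K) (psi : ghom H K) g x :
  dcoset (range phi) (range psi) g x ->
  dcoset (range phi) (range psi) g = dcoset (range phi) (range psi) x.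
Proof.
by apply: dcosetP;
  [exact: rangeM|exact: rangeV|exact: rangeM|exact: rangeV].
Qed.

Lemma conjg_mul (G : groupType) (s t : G) : (s * t * s^-1) ^ s = t.
Proof. by rewrite conjgE mulgVK mulKg. Qed.

(** * Reduced paths in a graph of groups *)

Section Reduced.
Variable A : gog.

(** Equations between paths are inverted through [path_head], as the vertices
    have no decidable equality. *)
Definition path_head (u w : A) (p : gpath u w) :
    option {v : A & (vgrp A u * edge u v * gpath v w)%type} :=
  match p with
  | pnil _ _ => None
  | pcons _ _ _ a e q => Some (existT _ _ (a, e, q))
  end.

Lemma pcons_inj_edge (u v v' w : A) a a' (e : edge u v) (e' : edge u v')
    (p : gpath v w) (p' : gpath v' w) :
  pcons a e p = pcons a' e' p' ->
  a = a' /\ existT _ v e = existT _ v' e' :> star u.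
Proof.
move=> /(congr1 (@path_head _ _)) /Some_inj E; split.
  exact: (congr1 (fun s => (projT2 s).1.1) E).
exact: (congr1 (fun s => existT _ (projT1 s) (projT2 s).1.2) E).
Qed.

Lemma pcons_inj (u v w : A) a a' (e : edge u v) (p p' : gpath v w) :
  pcons a e p = pcons a' e p' -> a = a' /\ p = p'.
Proof.
move=> /(congr1 (@path_head _ _)) /= H.
have {H} E := existT_inj (Some_inj H).
by split; [exact: (congr1 (fun s => s.1.1) E)|exact: (congr1 snd E)].
Qed.

Lemma pcons_star (u v v' w : A) (a : vgrp A u) (e : edge u v)
    (e' : edge u v') (p : gpath v w) :
  existT _ v e = existT _ v' e' :> star u ->
  exists p', pcons a e p = pcons a e' p'.
Proof. by move=> /existT_eq /= [E]; case: v' / E e' => e' /= <-; exists p. Qed.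

Lemma pnil_inj (u : A) : injective (pnil u).
Proof.
pose f (u w : A) (p : gpath u w) :=
  match p with pnil u a => Some (existT (vgrp A) u a) | _ => None end.
by move=> a b /(congr1 (@f u u)) /Some_inj; exact: existT_inj.
Qed.

Fixpoint path_len (u w : A) (p : gpath u w) : nat :=
  match p with pnil _ _ => 0 | pcons _ _ _ _ _ q => (path_len q).+1 end.

Lemma path_len_cast (u u' w w' : A) (h : u = u') (k : w = w') (p : gpath u w) :
  path_len (pcast h k p) = path_len p :> nat.
Proof. by case: w' / k; case: u' / h. Qed.

Definition backtracks (u v w : A) (e : edge u v) (p : gpath v w) : Prop :=
  exists (x : egrp A e) r, p = pcons (omega x) (einv e) r.

Fixpoint reduced (u w : A) (p : gpath u w) : Prop :=
  match p with
  | pnil _ _ => True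
  | pcons _ _ _ _ e q => reduced q /\ ~ backtracks e q
  end.

(** Moving edge group elements across the edges of a path.  The recursion on the
    first path gives [slide_refl], [slide_sym] and [slide_trans] without
    inverting equations between paths of unknown end points. *)
Fixpoint slide (u w : A) (p : gpath u w) : set (gpath u w) :=
  match p with
  | pnil u a => [set pnil u a]
  | pcons _ _ _ a e p => [set q | exists (x : egrp A e) p',
      slide p p' /\ q = pcons (a * alpha e x) e (lmulp (omega x)^-1 p')]
  end.

Lemma omega1 (u v : A) (e : edge u v) : omega (1 : egrp A e) = 1.
Proof. by rewrite /omega !gmulf1. Qed.

Lemma omegaM (u v : A) (e : edge u v) : {morph @omega A u v e : x y / x * y}.
Proof. by move=> x y; rewrite /omega !gmulfM. Qed.

Lemma omegaV (u v : A) (e : edge u v) : {morph @omega A u v e : x / x^-1}.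
Proof. by move=> x; rewrite /omega !gmulfV. Qed.

Lemma slide_refl (u w : A) (p : gpath u w) : slide p p.
Proof.
elim: p => [//|x y z a e p IH] /=.
by exists 1, p; rewrite gmulf1 omega1 invg1 mulg1 lmul1p.
Qed.

Lemma slide_lmul (u w : A) (a : vgrp A u) (p q : gpath u w) :
  slide p q -> slide (lmulp a p) (lmulp a q).
Proof.
case: p a q => [x b|x y z b e p] a q /=; first by move=> ->.
by move=> [t [p' [pp' ->]]]; exists t, p'; rewrite /= mulgA.
Qed.

Lemma slide_sym (u w : A) (p q : gpath u w) : slide p q -> slide q p.
Proof.
elim: p q => [x b|x y z b e p IH] q /=; first by move=> ->.
move=> [t [p' [/IH pp' ->]]] /=; exists t^-1, (lmulp (omega t)^-1 p).
split; first exact: slide_lmul.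
by rewrite gmulfV mulgK omegaV invgK lmulpM mulgV lmul1p.
Qed.

Lemma slide_trans (u w : A) (p q r : gpath u w) :
  slide p q -> slide q r -> slide p r.
Proof.
elim: p q r => [x b|x y z b e p IH] q r /=; first by move=> -> ->.
move=> [t [p' [pp' ->]]] /= [s [q' [/(slide_lmul (omega t)) H ->]]].
rewrite lmulpM mulgV lmul1p in H.
exists (t * s), (lmulp (omega t) q'); split; first exact: IH pp' H.
by rewrite gmulfM mulgA omegaM invgM lmulpM mulgVK.
Qed.

(** The product of the edge [e] with a reduced path, as a reduced path: it
    cancels when the path starts by undoing [e]. *)
Definition push (u v w : A) (e : edge u v) (p : gpath v w) : gpath u w :=
  match pselect (exists xr : egrp A e * gpath u w,
                   p = pcons (omega xr.1) (einv e) xr.2) with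
  | left h => lmulp (alpha e (sval (cid h)).1) (sval (cid h)).2
  | right _ => pcons 1 e p
  end.

Lemma push_cancel (u v w : A) (e : edge u v) (x : egrp A e) (r : gpath u w) :
  push e (pcons (omega x) (einv e) r) = lmulp (alpha e x) r.
Proof.
rewrite /push; case: pselect => [h|[]]; last by exists (x, r).
by case: (cid h) => -[x' r'] /= /pcons_inj [/omega_inj -> ->].
Qed.

Lemma push_pcons (u v w : A) (e : edge u v) (p : gpath v w) :
  ~ backtracks e p -> push e p = pcons 1 e p.
Proof.
rewrite /push; case: pselect => // h [].
by case: h => -[x r] /= ->; exists x, r.
Qed.

Lemma reduced_lmul (u w : A) (a : vgrp A u) (p : gpath u w) :
  reduced p -> reduced (lmulp a p).
Proof. by case: p a. Qed.

Lemma reduced_push (u v w : A) (e : edge u v) (p : gpath v w) :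
  reduced p -> reduced (push e p).
Proof.
case: (pselect (backtracks e p)) => [|H].
  by move=> [x [r ->]]; rewrite push_cancel => -[/reduced_lmul].
by rewrite push_pcons.
Qed.

(** An element of the group of [einv e] is the flip of an element of the group
    of [e], so that a slide across [einv e] can be stated with [omega] and
    [alpha] of [e]. *)
Lemma slide_cancel (u v w : A) (e : edge u v) (x : egrp A e) (r : gpath u w) q :
  slide (pcons (omega x) (einv e) r) q ->
  exists (y : egrp A e) r', slide r r' /\
    q = pcons (omega (x * y)) (einv e) (lmulp (alpha e y)^-1 r').
Proof.
move=> [y' [r' [rr' ->]]]; have [y <-] := flip_surj y'.
by exists y, r'; split=> //; rewrite omega_flip omegaM.
Qed.

Lemma slide_push (u v w : A) (e : edge u v) (p q : gpath v w) :
  slide p q -> slide (push e p) (push e q).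
Proof.
case: (pselect (backtracks e p)) => [|Hp].
  move=> [x [r ->]] /slide_cancel [y [r' [rr' ->]]].
  rewrite !push_cancel lmulpM gmulfM mulgK; exact: slide_lmul.
case: (pselect (backtracks e q)) => [|Hq].
  move=> [x [r ->]] /slide_sym /slide_cancel [y [r' [_ E]]].
  by case: Hp; exists (x * y), (lmulp (alpha e y)^-1 r').
move=> pq; rewrite !push_pcons //=; exists 1, q; split=> //.
by rewrite gmulf1 omega1 mulg1 invg1 lmul1p.
Qed.

(** With [push_push], this says that [push] respects the relations defining the
    fundamental groupoid. *)
Lemma push_omega (u v w : A) (e : edge u v) (x : egrp A e) (p : gpath v w) :
  slide (push e (lmulp (omega x) p)) (lmulp (alpha e x) (push e p)).
Proof.
case: (pselect (backtracks e p)) => [|Hp].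
  move=> [y [r ->]] /=; rewrite -omegaM !push_cancel lmulpM -gmulfM.
  exact: slide_refl.
have Hp' : ~ backtracks e (lmulp (omega x) p).
  move=> [y [r E]]; apply: Hp; exists (x^-1 * y), r.
  by rewrite -[p]lmul1p -(mulVg (omega x)) -lmulpM E /= omegaM omegaV.
rewrite !push_pcons //=; exists x, (lmulp (omega x) p); split.
  exact: slide_refl.
by rewrite mul1g mulg1 lmulpM mulVg lmul1p.
Qed.

(** Reducedness matters when [e] cancels in [p]: what remains of [p] must not
    start with [e] again, or the second [push] would cancel as well. *)
Lemma push_push (u v w : A) (e : edge u v) (p : gpath v w) :
  reduced p -> slide (push (einv e) (push e p)) p.
Proof.
case: (pselect (backtracks e p)) => [|Hp _].
  move=> [x [r ->]] [_ Hr]; rewrite push_cancel.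
  have := push_omega (flip e x) r; rewrite omega_flip (push_pcons Hr).
  by rewrite /= mulg1.
rewrite (push_pcons Hp).
have := push_cancel (1 : egrp A (einv e)) p.
rewrite omega1 einvK gmulf1 lmul1p => ->; exact: slide_refl.
Qed.

(** An action up to slides on reduced paths: words acting on normal forms, as in
    van der Waerden's treatment of free products. *)
Fixpoint path_act (u v w : A) (p : gpath u v) : gpath v w -> gpath u w :=
  match p in gpath u v return gpath v w -> gpath u w with
  | pnil _ a => lmulp a
  | pcons _ _ _ a e p => fun q => lmulp a (push e (path_act p q))
  end.

Lemma path_act_lmul (u v w : A) (a : vgrp A u) (p : gpath u v) (q : gpath v w) :
  path_act (lmulp a p) q = lmulp a (path_act p q).
Proof. by case: p a q => [x b|x y z b e p] a q /=; rewrite lmulpM. Qed.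

Lemma path_act_cat (t u v w : A) (p : gpath t u) (q : gpath u v)
    (r : gpath v w) :
  path_act (pcat p q) r = path_act p (path_act q r).
Proof.
elim: p q => [x b|x y z b e p IH] q /=; first by rewrite path_act_lmul.
by rewrite IH.
Qed.

Lemma reduced_path_act (u v w : A) (p : gpath u v) (q : gpath v w) :
  reduced q -> reduced (path_act p q).
Proof.
elim: p q => [x b|x y z b e p IH] q rq /=; first exact: reduced_lmul.
by apply/reduced_lmul/reduced_push/IH.
Qed.

Lemma slide_path_act (u v w : A) (p : gpath u v) (q r : gpath v w) :
  slide q r -> slide (path_act p q) (path_act p r).
Proof.
elim: p q r => [x b|x y z b e p IH] q r qr /=; first exact: slide_lmul.
by apply/slide_lmul/slide_push/IH.
Qed.

Lemma path_act_path_eq (u v w : A) (p q : gpath u v) (r : gpath v w) :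
  path_eq p q -> reduced r -> slide (path_act p r) (path_act q r).
Proof.
move=> pq; elim: pq w r => {u v p q}
    [u v e x|u v p|u v p q _ IH|u v p q r _ IH1 _ IH2
    |u v t p p' q q' _ IHp _ IHq] w s rs.
- rewrite /= !lmul1p; apply: slide_trans (push_omega x _) _.
  apply: slide_lmul; have := push_push (einv e) rs; by rewrite einvK.
- exact: slide_refl.
- exact/slide_sym/IH.
- exact: slide_trans (IH1 _ _ rs) (IH2 _ _ rs).
- rewrite !path_act_cat; apply: slide_trans (slide_path_act _ (IHq _ _ rs)) _.
  exact/IHp/reduced_path_act.
Qed.

Lemma path_act_reduced (u v : A) (p : gpath u v) :
  reduced p -> path_act p (pnil v 1) = p.
Proof.
elim: p => [x b|x y z b e p IH] /=; first by rewrite mulg1.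
by move=> [/IH -> Hp]; rewrite push_pcons //= mulg1.
Qed.

(** The normal form theorem: by [path_act_reduced] a reduced path is recovered
    from its action on the trivial path, and by [path_act_path_eq] this action
    depends, up to slides, only on the class of the path. *)
Lemma reduced_path_eq (u v : A) (p q : gpath u v) :
  reduced p -> reduced q -> path_eq p q -> slide p q.
Proof.
move=> rp rq /(@path_act_path_eq _ _ v _ _ (pnil v 1)) /(_ I).
by rewrite !path_act_reduced.
Qed.

Lemma path_eq_lmul (u v : A) (a : vgrp A u) (p q : gpath u v) :
  path_eq p q -> path_eq (lmulp a p) (lmulp a q).
Proof. exact: path_eq_cat (path_eq_refl (pnil u a)). Qed.

Lemma path_eq_cons (u v w : A) (a : vgrp A u) (e : edge u v) (p q : gpath v w) :
  path_eq p q -> path_eq (pcons a e p) (pcons a e q).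
Proof.
move=> pq; rewrite pcat_cons1 [X in path_eq _ X]pcat_cons1.
by apply: path_eq_cat pq; exact: path_eq_refl.
Qed.

Lemma path_eq_slide (u v w : A) (e : edge u v) (x : egrp A e) (a : vgrp A u)
    (p : gpath v w) :
  path_eq (pcons a e (lmulp (omega x) p)) (pcons (a * alpha e x) e p).
Proof.
have := path_eq_cat (path_eq_refl (pnil u a)) (path_eq_cat (path_eq_edge x)
  (path_eq_refl (pcons 1 e p))).
rewrite /= !mulg1; move=> H; apply: path_eq_trans H.
apply/path_eq_cons/path_eq_sym.
have := path_eq_cat (path_eq_edge (1 : egrp A (einv e))) (path_eq_refl p).
rewrite omega1 gmulf1 einvK /= !lmul1p => /(path_eq_lmul (omega x)) /=.
by rewrite mulg1.
Qed.

Lemma path_eq_push (u v w : A) (e : edge u v) (p : gpath v w) :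
  path_eq (push e p) (pcons 1 e p).
Proof.
case: (pselect (backtracks e p)) => [|Hp].
  move=> [x [r ->]]; rewrite push_cancel; apply: path_eq_sym.
  have := path_eq_cat (path_eq_edge x) (path_eq_refl r).
  by rewrite /= !lmul1p.
by rewrite push_pcons //; exact: path_eq_refl.
Qed.

Lemma reduced_exists (u v : A) (p : gpath u v) :
  exists2 q, path_eq p q & reduced q.
Proof.
elim: p => [x b|x y z b e p [q pq rq]].
  by exists (pnil x b); first exact: path_eq_refl.
exists (lmulp b (push e q)); last exact/reduced_lmul/reduced_push.
apply: path_eq_trans (path_eq_cons b e pq) _.
have := path_eq_lmul b (path_eq_push e q); rewrite /= mulg1.
exact: path_eq_sym.
Qed.

Lemma reduced_nil (u : A) (a : vgrp A u) (p : gpath u u) :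
  reduced p -> path_eq p (pnil u a) -> p = pnil u a.
Proof. by move=> rp /(@reduced_path_eq _ _ _ (pnil u a) rp I) /slide_sym. Qed.

End Reduced.

(** * Calculations in the fundamental groupoid *)

Notation "x ** y" := (pi_mul x y) (at level 40, left associativity).

Definition pi_vertex (A : gog) (u : A) (a : vgrp A u) : pi_hom u u :=
  pclass (pnil u a).
Definition pi_edge (A : gog) (u v : A) (e : edge u v) : pi_hom u v :=
  pclass (pcons 1 e (pnil v 1)).

Section Groupoid.
Variable A : gog.
Implicit Types t u v w : A.

Lemma pi_mulA t u v w (x : pi_hom t u) (y : pi_hom u v) (z : pi_hom v w) :
  x ** (y ** z) = x ** y ** z.
Proof.
rewrite -[x]pclass_repr -[y]pclass_repr -[z]pclass_repr.
by rewrite !pi_mulE pcatA.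
Qed.

Lemma pi_mul1 u v (x : pi_hom u v) : pi_vertex 1 ** x = x.
Proof. by rewrite -[x]pclass_repr pi_mulE /= lmul1p. Qed.

Lemma pi_mulr1 u v (x : pi_hom u v) : x ** pi_vertex 1 = x.
Proof. by rewrite -[x]pclass_repr pi_mulE pcatp1. Qed.

Lemma pi_mulV u v (x : pi_hom u v) : pi_inv x ** x = pi_vertex 1.
Proof.
by rewrite -[x]pclass_repr pi_invE pi_mulE; exact/pclassE/pcatVp.
Qed.

Lemma pi_invK u v (x : pi_hom u v) : pi_inv (pi_inv x) = x.
Proof. by rewrite -[x]pclass_repr !pi_invE Defs.pinvK. Qed.

Lemma pi_mulrV u v (x : pi_hom u v) : x ** pi_inv x = pi_vertex 1.
Proof. by rewrite -{1}[x]pi_invK pi_mulV. Qed.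

Lemma pi_mulK u v w (x : pi_hom u v) (y : pi_hom v w) : x ** y ** pi_inv y = x.
Proof. by rewrite -pi_mulA pi_mulrV pi_mulr1. Qed.

Lemma pi_mulVK u v w (x : pi_hom u v) (y : pi_hom w v) : x ** pi_inv y ** y = x.
Proof. by rewrite -pi_mulA pi_mulV pi_mulr1. Qed.

Lemma pi_mulKV u v w (x : pi_hom u v) (y : pi_hom v w) :
  pi_inv x ** (x ** y) = y.
Proof. by rewrite pi_mulA pi_mulV pi_mul1. Qed.

Lemma pi_conj_eq1 u v (x : pi_hom u v) (y : pi_hom v v) :
  x ** y ** pi_inv x = pi_vertex 1 -> y = pi_vertex 1.
Proof.
move=> Exy; rewrite -(pi_mulKV x y) -[x ** y](pi_mulK _ (pi_inv x)) pi_invK Exy.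
by rewrite pi_mul1 pi_mulV.
Qed.

(** The two sides are convertible but have different head symbols, so rewriting
    with groupoid identities needs the left one. *)
Lemma pi_mul_pi1 (u : A) (a b : pi1 u) : a ** b = a * b.
Proof. by []. Qed.

Lemma pi_vertexM u (a b : vgrp A u) :
  pi_vertex (a * b) = pi_vertex a ** pi_vertex b.
Proof. by rewrite /pi_vertex pi_mulE. Qed.

Lemma pi_vertexV u (a : vgrp A u) : pi_vertex a^-1 = pi_inv (pi_vertex a).
Proof. by rewrite /pi_vertex pi_invE. Qed.

Lemma pclass_cons u v w (a : vgrp A u) (e : edge u v) (p : gpath v w) :
  pclass (pcons a e p) = pi_vertex a ** pi_edge e ** pclass p.
Proof. by rewrite /pi_vertex /pi_edge !pi_mulE /= mulg1 lmul1p. Qed.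

Lemma pi_edge_slide u v (e : edge u v) (x : egrp A e) :
  pi_edge e ** pi_vertex (omega x) = pi_vertex (alpha e x) ** pi_edge e.
Proof.
rewrite /pi_edge /pi_vertex !pi_mulE; apply/pclassE => /=.
by have := path_eq_slide x 1 (pnil v 1); rewrite /= !mulg1 !mul1g.
Qed.

(** Induction on the length of a path representing the class. *)
Lemma pi_hom_ind (P : forall u w, pi_hom u w -> Prop) :
  (forall u (a : vgrp A u), P u u (pi_vertex a)) ->
  (forall u v w a (e : edge u v) (x : pi_hom v w), P v w x ->
     P u w (pi_vertex a ** pi_edge e ** x)) ->
  forall u w x, P u w x.
Proof.
move=> H0 H1 u w x; rewrite -[x]pclass_repr.
elim: (repr x) => [v a|v v' v'' a e p IH].
  exact: H0.
by rewrite pclass_cons; exact: H1.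
Qed.

End Groupoid.

(** * The functor induced by a morphism *)

Section Functor.
Variables (B A : gog) (mu : gog_mor B A).

(** The end points of the image are named independently of [mu], so that images
    under two morphisms can be composed when their end points agree. *)
Definition pi_map v w u u' (hv : mu v = u) (hw : mu w = u') (x : pi_hom v w) :
  pi_hom u u' := pclass (pcast hv hw (mor_path mu (repr x))).

Lemma pi_mapE v w u u' (hv : mu v = u) (hw : mu w = u') (p : gpath v w) :
  pi_map hv hw (pclass p) = pclass (pcast hv hw (mor_path mu p)).
Proof.
by case: u' / hw; case: u / hv; exact/pclassE/mor_path_eq/repr_pclass.
Qed.

Lemma pi_mapM t v w s u u' (ht : mu t = s) (hv : mu v = u) (hw : mu w = u')
    (x : pi_hom t v) (y : pi_hom v w) :
  pi_map ht hw (x ** y) = pi_map ht hv x ** pi_map hv hw y.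
Proof.
case: u' / hw; case: u / hv; case: s / ht.
rewrite -[x]pclass_repr -[y]pclass_repr pi_mulE !pi_mapE pi_mulE.
by rewrite /= mor_path_cat.
Qed.

Lemma pi_map_vertex v u (hv hv' : mu v = u) (b : vgrp B v) :
  pi_map hv hv' (pi_vertex b) = pi_vertex (vmap_at hv b).
Proof.
by rewrite (Prop_irrelevance hv' hv); case: u / hv {hv'}; rewrite pi_mapE.
Qed.

Lemma pi_mapV v w u u' (hv : mu v = u) (hw : mu w = u') (x : pi_hom v w) :
  pi_map hw hv (pi_inv x) = pi_inv (pi_map hv hw x).
Proof.
rewrite -[LHS]pi_mulr1 -(pi_mulrV (pi_map hv hw x)) pi_mulA -pi_mapM.
by rewrite pi_mulV pi_map_vertex gmulf1 pi_mul1.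
Qed.

Lemma pi_map_edge v v' u u' (f : edge v v') (e : edge u u')
    (hv : mu v = u) (hv' : mu v' = u') : over_edge mu f e ->
  pi_map hv hv' (pi_edge f) =
  pi_vertex (vcast hv (tw_alpha mu f)) ** pi_edge e **
  pi_inv (pi_vertex (vcast hv' (tw_omega mu f))).
Proof.
move=> h; case: _ _ _ / h hv hv' => hv hv'.
rewrite (Prop_irrelevance hv erefl) (Prop_irrelevance hv' erefl) /=.
rewrite pi_mapE /= pclass_cons !gmulf1 mul1g mulg1.
by rewrite -pi_vertexV.
Qed.

Lemma vmap_at_inj v u (h : mu v = u) : injective (vmap_at h).
Proof. by case: u / h; exact: gm_v_inj. Qed.

Lemma emap_at_inj (v v' : B) (f : edge v v')
  (u u' : A) (e : edge u u') (h : over_edge mu f e) : injective (emap_at h).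
Proof. by case: _ _ _ / h; exact: gm_e_inj. Qed.

Lemma vmap_at_alpha (v v' : B) (f : edge v v')
    (u u' : A) (e : edge u u') (hf : over_edge mu f e) (h : mu v = u)
    (x : egrp B f) :
  vmap_at h (alpha f x) * vcast h (tw_alpha mu f) =
  vcast h (tw_alpha mu f) * alpha e (emap_at hf x).
Proof. by rewrite (emap_at_alpha hf h) conjgE mulVKg. Qed.

Lemma vmap_at_alphaV (v v' : B) (f : edge v v')
    (u u' : A) (e : edge u u') (hf : over_edge mu f e) (h : mu v = u)
    (x : egrp B f) :
  alpha e (emap_at hf x) * (vcast h (tw_alpha mu f))^-1 =
  (vcast h (tw_alpha mu f))^-1 * vmap_at h (alpha f x).
Proof. by rewrite (emap_at_alpha hf h) conjgE !mulgA mulgK. Qed.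

Lemma vmap_at_omega (v v' : B) (f : edge v v')
    (u u' : A) (e : edge u u') (hf : over_edge mu f e) (h : mu v' = u')
    (x : egrp B f) :
  vmap_at h (omega x) * vcast h (tw_omega mu f) =
  vcast h (tw_omega mu f) * omega (emap_at hf x).
Proof. by rewrite (emap_at_omega hf h) conjgE mulVKg. Qed.

Lemma vmap_at_omegaV (v v' : B) (f : edge v v')
    (u u' : A) (e : edge u u') (hf : over_edge mu f e) (h : mu v' = u')
    (x : egrp B f) :
  omega (emap_at hf x) * (vcast h (tw_omega mu f))^-1 =
  (vcast h (tw_omega mu f))^-1 * vmap_at h (omega x).
Proof. by rewrite (emap_at_omega hf h) conjgE !mulgA mulgK. Qed.

Lemma pi1_imageE v u (h : mu v = u) :
  pi1_image mu h = range (pi_map h h : pi1 v -> pi1 u).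
Proof. by case: u / h. Qed.

Lemma pi1_imageM v u (h : mu v = u) (a b : pi1 u) :
  pi1_image mu h a -> pi1_image mu h b -> pi1_image mu h (a * b).
Proof.
rewrite !pi1_imageE => -[x _ <-] [y _ <-]; exists (x ** y) => //.
exact: pi_mapM.
Qed.

Lemma pi1_imageV v u (h : mu v = u) (a : pi1 u) :
  pi1_image mu h a -> pi1_image mu h a^-1.
Proof.
rewrite !pi1_imageE => -[x _ <-]; exists (pi_inv x) => //.
exact: pi_mapV.
Qed.

Lemma pi1_image_map v u (h : mu v = u)
    (x : pi_hom v v) : pi1_image mu h (pi_map h h x).
Proof. by rewrite pi1_imageE; exists x. Qed.

End Functor.

(** * Local injectivity and local surjectivity *)

Section LocalConditions.
Variables (B A : gog) (mu : gog_mor B A).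

(** The two parts mirror the two parts of the definition of an immersion, with
    elements in place of double cosets and subgroups: edges with the same double
    coset are equal, and the subgroup of a vertex meets that of an edge only in
    elements coming from the edge. *)
Definition locally_injective : Prop :=
  (forall (v v1 v2 : B) (f1 : edge v v1) (f2 : edge v v2)
      (u u' : A) (e : edge u u') (h : mu v = u) (b : vgrp B v) (z : egrp A e),
    over_edge mu f1 e -> over_edge mu f2 e ->
    vmap_at h b * vcast h (tw_alpha mu f1) * alpha e z =
      vcast h (tw_alpha mu f2) ->
    existT _ v1 f1 = existT _ v2 f2 :> star v) /\
  (forall (v v' : B) (f : edge v v') (u u' : A) (e : edge u u') (h : mu v = u)
      (b : vgrp B v) (z : egrp A e),
    over_edge mu f e ->
    vmap_at h b * vcast h (tw_alpha mu f) =
      vcast h (tw_alpha mu f) * alpha e z ->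
    exists x, b = alpha f x).

Definition locally_surjective : Prop :=
  forall (v : B) (u u' : A) (e : edge u u') (h : mu v = u) (a : vgrp A u),
  exists (v' : B) (f : edge v v') (b : vgrp B v) (z : egrp A e),
    over_edge mu f e /\ a = vmap_at h b * vcast h (tw_alpha mu f) * alpha e z.

Lemma over_edge_star v v' (f : edge v v') (u' : A) (e : edge (mu v) u') :
  over_edge mu f e <->
  star_map mu (existT _ v' f) = existT _ u' e.
Proof.
split=> [h|/existT_eq /= [E <-]]; last by case: u' / E e.
suff H (u u2 : A) (e2 : edge u u2) : over_edge mu f e2 ->
    forall h : mu v = u,
    existT (fun u2 => edge u u2) (mu v')
      (eq_rect _ (fun u => edge u (mu v')) (gmor_e mu f) _ h) = existT _ u2 e2.
  exact: (H _ _ _ h erefl).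
by case=> h2; rewrite (Prop_irrelevance h2 erefl).
Qed.

Lemma over_edge_unique (v v1 v2 : B) (f1 : edge v v1) (f2 : edge v v2)
    (u u1 u2 : A) (e1 : edge u u1) (e2 : edge u u2) (h : mu v = u) :
  over_edge mu f1 e1 -> over_edge mu f2 e2 ->
  existT _ v1 f1 = existT _ v2 f2 :> star v ->
  existT _ u1 e1 = existT _ u2 e2 :> star u.
Proof.
case: u / h e1 e2 => e1 e2 /over_edge_star <- /over_edge_star <- -> //.
Qed.

Lemma over_edge_transport (v v' : B) (f : edge v v') (u u1 u2 : A)
    (e1 : edge u u1) (e2 : edge u u2) :
  existT _ u1 e1 = existT _ u2 e2 :> star u ->
  over_edge mu f e2 -> over_edge mu f e1.
Proof. by case/existT_eq => /= Eu; case: u2 / Eu e2 => e2 /= ->. Qed.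

Lemma alpha_transport (u u1 u2 : A) (e1 : edge u u1) (e2 : edge u u2)
    (z : egrp A e2) :
  existT _ u1 e1 = existT _ u2 e2 :> star u ->
  exists z1, alpha e1 z1 = alpha e2 z.
Proof.
by case/existT_eq => /= Eu; case: u2 / Eu e2 z => e2 z /= ->; exists z.
Qed.

Lemma immersion_locally_injective : immersion mu -> locally_injective.
Proof.
move=> [inj1 inj2]; split.
  move=> v v1 v2 f1 f2 u u' e h b z; case: u / h e z => e z.
  move=> /over_edge_star H1 /over_edge_star H2 /= E.
  apply/(inj1 _ _ _ _ H1 H2) => /=; apply: dcoset_range; rewrite -E.
  by exists (gm_v mu v b), (alpha e z); split=> //.
move=> v v' f u u' e h b z oe; case: _ _ _ / oe h z => h z.
rewrite (Prop_irrelevance h erefl) /= => E.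
have : (alpha (gmor_e mu f) @` range (gm_e mu f)) (alpha _ z).
  rewrite inj2; split; last by exists z.
  by exists (gm_v mu v b); [exists b|rewrite conjgE E mulKg].
move=> [_ [x _ <-] /alpha_inj Ez]; exists x; apply: (@gm_v_inj _ _ mu).
by apply: (@mulIg _ (tw_alpha mu f)); rewrite E -Ez gm_alpha conjgE mulVKg.
Qed.

Lemma covering_locally_surjective : covering mu -> locally_surjective.
Proof.
move=> [_ cov] v u u' e h a; case: u / h e a => e a.
have [_ _ surj] := cov v.
have [|[v' f] _ E] := surj (existT _ u' e,
    dcoset (range (gm_v mu v)) (range (alpha e)) a).
  by exists a.
have E1 : star_map mu (existT _ v' f) = existT _ u' e := congr1 fst E.
pose F (s : star (mu v)) :=
  dcoset (range (gm_v mu v)) (range (alpha (projT2 s))).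
have E2 : F (star_map mu (existT _ v' f)) (tw_alpha mu f) = F (existT _ u' e) a.
  exact: (congr1 snd E).
rewrite E1 /F /= in E2; move/over_edge_star: (E1) => oe; exists v', f.
have : dcoset (range (gm_v mu v)) (range (alpha e)) a a.
  by exists 1, 1; split; rewrite ?mul1g ?mulg1 //; exists 1; rewrite // gmulf1.
rewrite -E2 => -[_ [_ [[b _ <-] [z _ <-] ->]]].
by exists b, z.
Qed.

(** A path is lifted edge by edge.  The double coset of an edge is only met up
    to an element of the edge group, which slides to the next vertex and remains
    as the final factor [a]. *)
Lemma path_lifting (u u' : A) (s : pi_hom u u') (v : B) (h : mu v = u) :
  locally_surjective ->
  exists (w : B) (hw : mu w = u') (t : pi_hom v w) (a : vgrp A u'),
    s = pi_map h hw t ** pi_vertex a.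
Proof.
move=> surj.
(* The group element [c] collects what the lift of an edge leaves over. *)
suff H (c : vgrp A u) : exists (w : B) (hw : mu w = u') (t : pi_hom v w)
    (a : vgrp A u'), pi_vertex c ** s = pi_map h hw t ** pi_vertex a.
  by have := H 1; rewrite pi_mul1.
elim/pi_hom_ind: u u' / s v h c => [u a|u u1 u' a e s IH] v h c.
  exists v, h, (pi_vertex 1), (c * a).
  by rewrite pi_map_vertex gmulf1 pi_mul1 pi_vertexM.
have [v1 [f [b [z [oe E]]]]] := surj v u u1 e h (c * a).
have h1 := over_edge_target oe.
have [w [hw [t [d Ed]]]] := IH v1 h1 (vcast h1 (tw_omega mu f) * omega z).
exists w, hw, (pi_vertex b ** pi_edge f ** t), d.
rewrite !(pi_mapM _ h1) !(pi_mapM _ h) pi_map_vertex (pi_map_edge _ _ oe).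
rewrite -[RHS]pi_mulA -Ed !pi_vertexM !pi_mulA pi_mulVK.
rewrite -(pi_mulA _ (pi_edge e) (pi_vertex _)) pi_edge_slide -pi_vertexM E.
by rewrite !pi_vertexM !pi_mulA.
Qed.

(** If the image of the path turned back after the edge [f], then the next edge
    would be [einv f] by the first part of local injectivity, and the element in
    between would come from the group of [f] by the second part. *)
Lemma reduced_mor_path (v w : B) (p : gpath v w) :
  locally_injective -> reduced p -> reduced (mor_path mu p).
Proof.
move=> [inj1 inj2]; elim: p => [//|v1 v2 v3 b f p IH] /= [rp nb].
split; first exact/reduced_lmul/IH.
move=> [x [r E]]; apply: nb.
case: p {rp IH} f x r E => [v4 c|v4 v5 v6 c f' p] f x r.
  by move=> /(congr1 (@path_len _ _ _)).
move=> /= /pcons_inj_edge [E1 /over_edge_star oe1].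
have oe2 := over_edge_inv (Over_edge mu f).
have E3 : gm_v mu v4 c * tw_alpha mu f' =
    tw_alpha mu (einv f) * alpha (einv (gmor_e mu f)) (flip _ x).
  by rewrite tw_alpha_inv -[alpha _ _]/(omega x) -E1 mulVKg.
have : existT _ v5 f' = existT _ v1 (einv f) :> star v4.
  apply: (inj1 _ _ _ _ _ _ _ _ erefl c (flip _ x^-1) oe1 oe2).
  by rewrite /= E3 !gmulfV mulgK.
move=> Ef; have [p' ->] := pcons_star c p Ef.
have /= Et := congr1 (fun s => tw_alpha mu (projT2 s)) Ef; rewrite Et in E3.
have [y' Ec] := inj2 _ _ _ _ _ _ erefl _ _ oe2 E3.
have [y Ey] := flip_surj y'; exists y, p'.
by rewrite Ec -Ey.
Qed.

(** The image of a reduced representative is reduced, so by the normal form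
    theorem it is the path of length 0 formed by [a]. *)
Lemma pi_map_eq_vertex (v w : B) u (hv : mu v = u) (hw : mu w = u)
    (x : pi_hom v w) (a : vgrp A u) :
  locally_injective -> pi_map hv hw x = pi_vertex a ->
  exists2 b : vgrp B v, a = vmap_at hv b &
    exists E : v = w, x = eq_rect v (pi_hom v) (pi_vertex b) w E.
Proof.
move=> inj; rewrite -[x]pclass_repr.
have [p /pclassE -> rp] := reduced_exists (repr x).
rewrite pi_mapE => /pclassE /reduced_nil H.
have {}H : pcast hv hw (mor_path mu p) = pnil u a.
  apply: H; have := reduced_mor_path inj rp.
  move: (mor_path mu p) => q; case: u / hw hv a => hv a.
  by move: (mu v) hv q => u hv; case: _ / hv.
move: (congr1 (@path_len _ _ _) H); rewrite path_len_cast.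
case: p {rp} hv hw H => // v' b hv hw /= H _; exists b; last by exists erefl.
apply: (@pnil_inj A); rewrite -H (Prop_irrelevance hw hv).
by case: u / hv a {H hw}.
Qed.

Lemma pi_map_loop_eq_vertex (v : B) u (h h' : mu v = u) (x : pi_hom v v)
    (a : vgrp A u) : locally_injective -> pi_map h h' x = pi_vertex a ->
  exists2 b : vgrp B v, a = vmap_at h b & x = pi_vertex b.
Proof.
move=> inj /(pi_map_eq_vertex inj) [b -> [E]].
by rewrite (Prop_irrelevance E erefl) => ->; exists b.
Qed.

Lemma pi_map_inj (v w : B) u u' (hv : mu v = u) (hw : mu w = u') :
  locally_injective -> injective (pi_map hv hw : pi_hom v w -> pi_hom u u').
Proof.
move=> inj x y E; have := pi_mapM hv hw hv x (pi_inv y).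
rewrite pi_mapV E pi_mulrV => /(pi_map_loop_eq_vertex inj) [b Eb Ex].
have b1 : b = 1 by apply: (@vmap_at_inj _ _ mu _ _ hv); rewrite -Eb gmulf1.
by rewrite -[x]pi_mulr1 -(pi_mulV y) pi_mulA Ex b1 pi_mul1.
Qed.

End LocalConditions.

(** * The projections of the product *)

Section PullbackProjections.
Variables (G H K : groupType) (phi : ghom G K) (psi : ghom H K) (k : K).

Definition pullback_fst (z : pullback phi psi k) : G := (val z).1.
Definition pullback_snd (z : pullback phi psi k) : H := (val z).2.

Lemma pullback_fst_morph : {morph pullback_fst : x y / x / y}.
Proof. by move=> x y; rewrite /pullback_fst gmulfM gmulfV. Qed.

Lemma pullback_snd_morph : {morph pullback_snd : x y / x / y}.
Proof. by move=> x y; rewrite /pullback_snd gmulfM gmulfV. Qed.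

HB.instance Definition _ :=
  isGroupMorphism.Build (pullback phi psi k) G pullback_fst pullback_fst_morph.
HB.instance Definition _ :=
  isGroupMorphism.Build (pullback phi psi k) H pullback_snd pullback_snd_morph.

Lemma pullback_eq (z : pullback phi psi k) :
  phi (pullback_fst z) ^ k = psi (pullback_snd z).
Proof. by apply/eqP; exact: (pullbackP z). Qed.

Lemma pullback_fst_inj : injective psi -> injective pullback_fst.
Proof.
move=> inj y z E; apply: val_inj.
have E2 : pullback_snd y = pullback_snd z.
  by apply: inj; rewrite -!pullback_eq E.
by rewrite [LHS]surjective_pairing [RHS]surjective_pairing; congr (_, _).
Qed.

Lemma pullback_snd_inj : injective phi -> injective pullback_snd.
Proof.
move=> inj y z E; apply: val_inj.
have E2 : pullback_fst y = pullback_fst z.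
  by apply: inj; apply: (@conjg_inj _ k); rewrite !pullback_eq E.
by rewrite [LHS]surjective_pairing [RHS]surjective_pairing; congr (_, _).
Qed.

End PullbackProjections.

Section Projections.
Variables (A B C : gog) (muB : gog_mor B A) (muC : gog_mor C A).
Variable r : product_reps muB muC.
Notation E := (gog_product r).

Definition proj_graph_l : graph_mor E B :=
  @GraphMor E B (@pv_v _ _ _ muB muC) (@pe_f _ _ _ muB muC)
    (fun _ _ _ => erefl).

Definition proj_graph_r : graph_mor E C :=
  @GraphMor E C (@pv_w _ _ _ muB muC) (@pe_g _ _ _ muB muC)
    (fun _ _ _ => erefl).

Lemma rep_b_invK (x y : E) (h : edge x y) :
  rep_b r (pedge_inv (pedge_inv h)) = rep_b r h.
Proof. by rewrite pedge_invK. Qed.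

Lemma rep_c_invK (x y : E) (h : edge x y) :
  rep_c r (pedge_inv (pedge_inv h)) = rep_c r h.
Proof. by rewrite pedge_invK. Qed.

(** The edge group of [h] is embedded in the vertex group after conjugation by
    [(rep_b r h, rep_c r h)], so these elements are the twists of the
    projections. *)
Definition proj_l : gog_mor E B :=
  @GogMor E B proj_graph_l
    (fun x => @pullback_fst _ _ _ _ _ _)
    (fun x y h => @pullback_fst _ _ _ _ _ _)
    (fun x => pullback_fst_inj (@vmap_at_inj _ _ muC _ _ (pv_hw x)))
    (fun x y h => pullback_fst_inj (@emap_at_inj _ _ muC _ _ _ _ _ _ (pe_hg h)))
    (fun x y h => rep_b r h) (fun x y h => rep_b r (pedge_inv h))
    (fun x y h => erefl) rep_b_invK
    (fun x y h z => esym (conjg_mul (rep_b r h) _))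
    (fun x y h z => esym (conjg_mul (rep_b r (pedge_inv h)) _)).

Definition proj_r : gog_mor E C :=
  @GogMor E C proj_graph_r
    (fun x => @pullback_snd _ _ _ _ _ _)
    (fun x y h => @pullback_snd _ _ _ _ _ _)
    (fun x => pullback_snd_inj (@vmap_at_inj _ _ muB _ _ (pv_hv x)))
    (fun x y h => pullback_snd_inj (@emap_at_inj _ _ muB _ _ _ _ _ _ (pe_hf h)))
    (fun x y h => rep_c r h) (fun x y h => rep_c r (pedge_inv h))
    (fun x y h => erefl) rep_c_invK
    (fun x y h z => esym (conjg_mul (rep_c r h) _))
    (fun x y h z => esym (conjg_mul (rep_c r (pedge_inv h)) _)).

Lemma pe_setM (x y : E) (h : edge x y) a j k : pe_set h a ->
  pe_set h (emap_at (pe_hf h) j * a * emap_at (pe_hg h) k).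
Proof.
have [c ->] := pe_setP h => -[_ [_ [[j' _ <-] [k' _ <-] ->]]].
exists (emap_at (pe_hf h) (j * j')), (emap_at (pe_hg h) (k' * k)).
by split=> //; rewrite !gmulfM !mulgA.
Qed.

(** An edge of the product is determined by its two projections and one element
    of its double coset; its end is then determined by [pe_terminus]. *)
Lemma product_star_eq (x y1 y2 : E) (h1 : edge x y1) (h2 : edge x y2) a1 a2 :
  existT _ (pv_v y1) (pe_f h1) = existT _ (pv_v y2) (pe_f h2)
    :> star (pv_v x) ->
  existT _ (pv_w y1) (pe_g h1) = existT _ (pv_w y2) (pe_g h2)
    :> star (pv_w x) ->
  pe_set h1 a1 -> pe_set h2 a2 ->
  alpha (pe_e h1) a1 = alpha (pe_e h2) a2 ->
  existT _ y1 h1 = existT _ y2 h2 :> star x.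
Proof.
move=> Ef Eg; have := over_edge_unique (pv_hw x) (pe_hg h1) (pe_hg h2) Eg.
case: y1 h1 a1 Ef Eg => u1 v1 w1 hv1 hw1 S1 HS1.
case: y2 h2 a2 => u2 v2 w2 hv2 hw2 S2 HS2 /= h2 a2 h1 a1.
case: h1 a1 => e1 f1 g1 hf1 hg1 X1 HX1 ho1 ht1 a1.
case: h2 a2 => e2 f2 g2 hf2 hg2 X2 HX2 ho2 ht2 a2 /=.
case/existT_eq => /= Ev Ef; subst v2; simpl in Ef; subst f2.
case/existT_eq => /= Ew Eg; subst w2; simpl in Eg; subst g2.
case/existT_eq => /= Eu Ee; destruct Eu; simpl in Ee; subst e2.
have E := Prop_irrelevance hv2 hv1; subst hv2.
have {}E := Prop_irrelevance hw2 hw1; subst hw2.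
have {}E := Prop_irrelevance hf2 hf1; subst hf2.
have {}E := Prop_irrelevance hg2 hg1; subst hg2.
move=> Xa1 Xa2 /alpha_inj E; subst a2.
have EX : X1 = X2.
  have [c1 E1] := HX1; have [c2 E2] := HX2; move: (Xa1) (Xa2); rewrite E1 E2.
  by move=> /dcoset_range -> /dcoset_range ->.
subst X2.
have ES : S1 = S2 by rewrite [LHS](ht1 _ Xa1) [RHS](ht2 _ Xa1).
subst S2.
have E := Prop_irrelevance HS2 HS1; subst HS2.
have {}E := Prop_irrelevance HX2 HX1; subst HX2.
have {}E := Prop_irrelevance ho2 ho1; subst ho2.
have {}E := Prop_irrelevance ht2 ht1; subst ht2.
by [].
Qed.

Lemma erep_eq (x y : E) (h : edge x y) :
  vcast (pv_hv x) (tw_alpha muB (pe_f h)) =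
  (vmap_at (pv_hv x) (rep_b r h))^-1 * vrep r x *
  vmap_at (pv_hw x) (rep_c r h) * vcast (pv_hw x) (tw_alpha muC (pe_g h)) *
  (alpha (pe_e h) (erep r h))^-1.
Proof. by rewrite (rep_eq r h) !mulgA mulVg mul1g mulgVK mulgVK mulgK. Qed.

Lemma vrep_comm (x : E) (b : vgrp E x) :
  vmap_at (pv_hv x) (val b).1 * vrep r x =
  vrep r x * vmap_at (pv_hw x) (val b).2.
Proof.
rewrite -[RHS]/(_ * vmap_at _ (pullback_snd b)) -pullback_eq.
by rewrite conjgE mulVKg.
Qed.

Lemma pv_set_dcoset (x : E) a : pv_set x a ->
  pv_set x = dcoset (range (vmap_at (pv_hv x))) (range (vmap_at (pv_hw x))) a.
Proof. by have [d ->] := pv_setP x => /dcoset_range. Qed.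

(** Local injectivity is inherited from [muB], as for any pullback.  Two edges
    at [x] with the same right projection and the same coset have left
    projections related in the same way over [A], and these are equal by local
    injectivity of [muB]. *)
Lemma proj_r_locally_injective :
  locally_injective muB -> locally_injective proj_r.
Proof.
move=> [inj1 inj2]; split.
  move=> x y1 y2 h1 h2 w w' g h b z; case: w / h g z => g z /=.
  move=> /over_edge_star E1 /over_edge_star E2.
  have [Ew Eg] := existT_eq E1; simpl in Ew, Eg; subst w'; simpl in Eg; subst g.
  rewrite -[gm_v proj_r x b]/(pullback_snd b) => Ec.
  have Eg : existT _ (pv_w y1) (pe_g h1) = existT _ (pv_w y2) (pe_g h2)
      :> star (pv_w x).
    by rewrite -E2.
  have Ee := over_edge_unique (pv_hw x) (pe_hg h1) (pe_hg h2) Eg.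
  have oe2 := over_edge_transport Ee (pe_hf h2).
  have [zeta Ezeta] := alpha_transport (erep r h2) Ee.
  have Etw : tw_alpha muC (pe_g h2) = tw_alpha muC (pe_g h1).
    by have /= := congr1 (fun s => tw_alpha muC (projT2 s)) Eg.
  (* Both edges start at [x], so [vrep r x] expresses [f_alpha] of one edge
     through that of the other. *)
  have Ex : vmap_at (pv_hv x) ((rep_b r h2)^-1 * pullback_fst b * rep_b r h1) *
      vcast (pv_hv x) (tw_alpha muB (pe_f h1)) *
      alpha (pe_e h1) (erep r h1 * emap_at (pe_hg h1) z * zeta^-1) =
      vcast (pv_hv x) (tw_alpha muB (pe_f h2)).
    rewrite (erep_eq h2) Etw -Ec (erep_eq h1) !gmulfM !gmulfV Ezeta.
    rewrite !mulgA; congr (_ / _).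
    rewrite mulgVK mulgK -!mulgA; congr (_ * _).
    by rewrite (vmap_at_alpha (pe_hg h1)) !mulgA -vrep_comm.
  have Ef := inj1 _ _ _ _ _ _ _ _ (pv_hv x) _ _ (pe_hf h1) oe2 Ex.
  have Etf : tw_alpha muB (pe_f h2) = tw_alpha muB (pe_f h1).
    by have /= := congr1 (fun s => tw_alpha muB (projT2 s)) Ef.
  rewrite Etf in Ex.
  have [j Ej] : exists j,
      (rep_b r h2)^-1 * pullback_fst b * rep_b r h1 = alpha (pe_f h1) j.
    apply: (inj2 _ _ _ _ _ _ (pv_hv x) _
      (erep r h1 * emap_at (pe_hg h1) z * zeta^-1)^-1 (pe_hf h1)).
    by rewrite -{2}Ex gmulfV mulgK.
  move: Ex; rewrite Ej (vmap_at_alpha (pe_hf h1)) -mulgA -gmulfM.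
  rewrite -[RHS]mulg1 => /mulgI /eqP.
  rewrite gmulf_eq1; last exact: alpha_inj.
  move=> /eqP Ek.
  (* The edge [h2] contains [erep r h2] by choice, and [h1] contains the same
     element written as [emap j * erep r h1 * emap z]. *)
  apply: (product_star_eq Ef Eg (pe_setM j z (erepP r h1)) (erepP r h2)).
  rewrite -Ezeta; congr (alpha _ _); apply: divg1_eq.
  by rewrite -Ek !mulgA.
move=> x y h w w' g hw b z oe; case: _ _ _ / oe hw z => hw z.
rewrite (Prop_irrelevance hw erefl) {hw} /=.
rewrite -[gm_v proj_r x b]/(pullback_snd b) => Ec.
have Eb : vmap_at (pv_hv x) ((rep_b r h)^-1 * pullback_fst b * rep_b r h) *
    vcast (pv_hv x) (tw_alpha muB (pe_f h)) =
    vcast (pv_hv x) (tw_alpha muB (pe_f h)) *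
    alpha (pe_e h) (erep r h * emap_at (pe_hg h) z * (erep r h)^-1).
  have Ec' :
      vmap_at (pv_hw x) (pullback_snd b) * vmap_at (pv_hw x) (rep_c r h) =
      vmap_at (pv_hw x) (rep_c r h) * vmap_at (pv_hw x) (alpha (pe_g h) z).
    by rewrite -!gmulfM; congr (vmap_at _ _); exact: Ec.
  rewrite (erep_eq h) !gmulfM !gmulfV !mulgA !mulgVK mulgK; congr (_ / _).
  rewrite -!mulgA; congr (_ * _); rewrite -(vmap_at_alpha (pe_hg h) (pv_hw x)).
  rewrite !mulgA vrep_comm; congr (_ * _); rewrite -!mulgA; congr (_ * _).
  exact: Ec'.
have [j Ej] := inj2 _ _ _ _ _ _ _ _ _ (pe_hf h) Eb.
move: Eb; rewrite Ej (vmap_at_alpha (pe_hf h)) => /mulgI /alpha_inj Ejz.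
have jz :
    pullback_pred (emap_at (pe_hf h)) (emap_at (pe_hg h)) (erep r h) (j, z).
  by apply/eqP; rewrite /= Ejz conjgE mulgVK mulKg.
exists (Pullback jz); apply: val_inj => /=.
rewrite -Ej -Ec !mulgA mulgV mul1g !mulgK.
exact: surjective_pairing.
Qed.

(** Local surjectivity is inherited from [muB].  To reach the edge [g] with the
    element [c], the element [x~ * c * g_alpha] of the vertex group of [A] is
    written as [b * f_alpha * z] with an edge [f] of [B]; the double coset of
    [z] is then an edge of the product. *)
Lemma proj_r_locally_surjective :
  locally_surjective muB -> locally_surjective proj_r.
Proof.
move=> surj x w w' g h c; case: w / h g c => /= g c.
have [u' [e hg]] : exists u' (e : edge (pv_u x) u'), over_edge muC g e.
  case: x g c => u v w hv /= hw S HS g c; case: u / hw hv S HS => hv S HS.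
  by exists (muC w'), (gmor_e muC g).
have hw' := over_edge_target hg.
have [v' [f [b [z [hf Ez]]]]] := surj (pv_v x) _ _ e (pv_hv x)
  (vrep r x * vmap_at (pv_hw x) c * vcast (pv_hw x) (tw_alpha muC g)).
have hv' := over_edge_target hf.
pose S := dcoset (range (vmap_at hv')) (range (vmap_at hw'))
  (vcast hv' (tw_omega muB f) * omega z * (vcast hw' (tw_omega muC g))^-1).
pose y := @PVertex _ _ _ muB muC u' v' w' hv' hw' S (ex_intro _ _ erefl).
pose X := dcoset (range (emap_at hf)) (range (emap_at hg)) z.
have ho a : X a -> pv_set x = origin_coset (x := x) (y := y) f g a.
  move=> [_ [_ [[j _ <-] [k _ <-] ->]]].
  rewrite (pv_set_dcoset (vrepP r x)); apply: dcoset_range.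
  exists (vmap_at (pv_hv x) (alpha f j * b^-1)),
    (vmap_at (pv_hw x) (c * alpha g k)).
  split; [by eexists|by eexists|].
  rewrite !gmulfM gmulfV !mulgA -(vmap_at_alpha hf) -!mulgA; congr (_ * _).
  rewrite !mulgA -[LHS]mulgA vmap_at_alphaV !mulgA; congr (_ * _).
  apply: (@mulIg _ (vcast (pv_hw x) (tw_alpha muC g))).
  by rewrite mulgVK -!mulgA [X in _ = _ * X]mulgA Ez !mulgA mulVg mul1g.
have ht a : X a -> pv_set y = terminus_coset (x := x) (y := y) f g a.
  move=> [_ [_ [[j _ <-] [k _ <-] ->]]]; apply: dcoset_range.
  exists (vmap_at hv' (omega j)), (vmap_at hw' (omega k)).
  split; [by eexists|by eexists|].
  rewrite !omegaM !mulgA -(vmap_at_omega hf) -!mulgA; congr (_ * (_ * (_ * _))).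
  exact: vmap_at_omegaV.
pose h := @PEdge _ _ _ _ _ x y e f g hf hg X (ex_intro _ _ erefl) ho ht.
exists y, h.
have [_ [_ [[j _ <-] [k _ <-] Er]]] := erepP r h.
(* The edge group element [(j, k)] measures how far [erep r h] is from [z];
   [b0] and [c0] correct [b] and [c] accordingly. *)
pose b0 := b * alpha f j^-1 * (rep_b r h)^-1.
pose c0 := c * alpha g k * (rep_c r h)^-1.
have bc0 :
    pullback_pred (vmap_at (pv_hv x)) (vmap_at (pv_hw x)) (vrep r x) (b0, c0).
  apply/eqP; rewrite /= conjgE; apply: (@mulgI _ (vrep r x)); rewrite mulVKg.
  have := rep_eq r h; rewrite /= Er => {1}->.
  rewrite /b0 /c0 !gmulfM !gmulfV !mulgA !mulgVK; congr (_ / _).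
  rewrite -!(mulgA _ (alpha e (emap_at hg k))) (vmap_at_alphaV hg) !mulgA.
  congr (_ * _).
  apply: (@mulIg _ (vcast (pv_hw x) (tw_alpha muC g))); rewrite mulgVK Ez.
  congr (_ * _); rewrite -!mulgA; congr (_ * _).
  by rewrite -(vmap_at_alpha hf) mulKg.
exists (Pullback bc0), k^-1; split; first exact: (Over_edge proj_r h).
by rewrite gmulfV /= -[pullback_snd _]/c0 /c0 mulgVK mulgK.
Qed.

Lemma product_square_edge (x y : E) (h : edge x y) :
  pi_map (pv_hv x) (pv_hv y) (pi_map (mu := proj_l) erefl erefl (pi_edge h)) **
    pi_vertex (vrep r y) =
  pi_vertex (vrep r x) **
    pi_map (pv_hw x) (pv_hw y) (pi_map (mu := proj_r) erefl erefl (pi_edge h)).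
Proof.
rewrite (pi_map_edge _ _ (Over_edge proj_l h)).
rewrite (pi_map_edge _ _ (Over_edge proj_r h)).
rewrite !(pi_mapM _ (pv_hv y)) !(pi_mapM _ (pv_hw y)) !pi_mapV.
rewrite !(pi_mapM _ (pv_hv x)) !(pi_mapM _ (pv_hw x)) !pi_map_vertex.
rewrite (pi_map_edge _ _ (pe_hf h)) (pi_map_edge _ _ (pe_hg h)) /=.
(* The equation for [vrep] at the origin of the inverse edge. *)
have Ey : vrep r y = vmap_at (pv_hv y) (rep_b r (pedge_inv h)) *
    vcast (pv_hv y) (tw_omega muB (pe_f h)) * omega (erep r h) *
    (vcast (pv_hw y) (tw_omega muC (pe_g h)))^-1 *
    (vmap_at (pv_hw y) (rep_c r (pedge_inv h)))^-1.
  by have := rep_eq r (pedge_inv h); rewrite /= !tw_alpha_inv erep_inv.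
rewrite Ey !pi_vertexM !pi_vertexV !pi_mulA !pi_mulVK; congr (_ ** _ ** _).
rewrite -(pi_mulA _ (pi_edge _) (pi_vertex _)) pi_edge_slide !pi_mulA.
congr (_ ** _).
by rewrite -!pi_vertexM erep_eq !mulgA mulgVK mulgV mul1g.
Qed.

(** For a vertex group element this is the definition of the vertex groups of
    the product, and for an edge it is the equation defining [rep_b] and
    [rep_c]. *)
Lemma product_square (x y : E) (s : pi_hom x y) :
  pi_map (pv_hv x) (pv_hv y) (pi_map (mu := proj_l) erefl erefl s) **
    pi_vertex (vrep r y) =
  pi_vertex (vrep r x) **
    pi_map (pv_hw x) (pv_hw y) (pi_map (mu := proj_r) erefl erefl s).
Proof.
elim/pi_hom_ind: x y / s => [x b|x y z b h s IH].
  rewrite !pi_map_vertex -!pi_vertexM -[vmap_at erefl b]/(pullback_fst _).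
  by rewrite vrep_comm.
rewrite !(pi_mapM _ (erefl : proj_l y = _)) !(pi_mapM _ (erefl : proj_r y = _)).
rewrite !(pi_mapM _ (pv_hv y)) !(pi_mapM _ (pv_hw y)) -pi_mulA IH !pi_mulA.
congr (_ ** _).
rewrite !(pi_mapM _ (erefl : proj_l x = _)) !(pi_mapM _ (erefl : proj_r x = _)).
rewrite !(pi_mapM _ (pv_hv x)) !(pi_mapM _ (pv_hw x)) -pi_mulA.
rewrite product_square_edge !pi_mulA; congr (_ ** _).
by rewrite !pi_map_vertex -!pi_vertexM; congr pi_vertex; exact: vrep_comm.
Qed.

(** A converse of [product_square].  The path [t] lifts to the product; local
    injectivity of [muB] shows that the lift can be chosen to end at [y]. *)
Lemma product_path (x y : E) (s : pi_hom (pv_v x) (pv_v y))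
    (t : pi_hom (pv_w x) (pv_w y)) :
  locally_injective muB -> locally_surjective muB ->
  pi_map (pv_hv x) (pv_hv y) s ** pi_vertex (vrep r y) =
    pi_vertex (vrep r x) ** pi_map (pv_hw x) (pv_hw y) t ->
  exists s' : pi_hom x y, pi_map (mu := proj_r) erefl erefl s' = t.
Proof.
move=> inj surj Est.
have [z [hz [s' [c Et]]]] := path_lifting t (erefl : proj_r x = pv_w x)
  (proj_r_locally_surjective surj).
case: y s t Est hz c Et => u v w hv hw S HS s t Est /= hz c Et.
case: z s' hz Et => u' v' w' hv' hw' S' HS' s' /= hz Et.
subst w; have Eu : u' = u by rewrite -hw -hw'.
destruct Eu; have Ehw := Prop_irrelevance hw' hw; subst hw'.
have Esq := product_square s'.
set y := PVertex HS in s t Est Et *; set z := PVertex HS' in s' Et Esq *.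
(* The lift [s'] of [t] ends at [z].  Its left projection differs from [s] by
   a path whose image is a vertex group element; such a path has length 0. *)
have Ez : pi_map hv' hv (pi_inv (pi_map (mu := proj_l) erefl erefl s') ** s) =
    pi_vertex (vrep r z * vmap_at hw c * (vrep r y)^-1).
  rewrite (pi_mapM _ (pv_hv x)) pi_mapV !pi_vertexM pi_vertexV.
  rewrite -[LHS](pi_mulK _ (pi_vertex (vrep r y))).
  rewrite -(pi_mulA _ _ (pi_vertex (vrep r y))).
  rewrite [X in _ ** X ** _]Est Et (pi_mapM _ (pv_hw z)) pi_map_vertex !pi_mulA.
  congr (_ ** _ ** _); rewrite -(pi_mulA _ (pi_vertex (vrep r x))).
  rewrite -[X in _ ** X = _]Esq; exact: pi_mulKV.
have [b Eb [Ev _]] := pi_map_eq_vertex inj Ez.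
destruct Ev; have Ehv := Prop_irrelevance hv' hv; subst hv'.
(* Hence [z] is [y], and the element left over lies in its vertex group. *)
have ES : S = S'.
  have Hy : S (vrep r y) := vrepP r y; have Hz : S' (vrep r z) := vrepP r z.
  rewrite [S](pv_set_dcoset (x := y) Hy) [S'](pv_set_dcoset (x := z) Hz).
  apply: dcoset_range; exists (vmap_at hv b), (vmap_at hw c^-1).
  split; [by exists b|by exists c^-1|].
  by rewrite -Eb gmulfV mulgVK mulgK.
subst S'; have EHS := Prop_irrelevance HS' HS; subst HS'.
have bc : pullback_pred (vmap_at hv) (vmap_at hw) (vrep r z) (b, c).
  by apply/eqP; rewrite /= conjgE -Eb mulgVK mulKg.
exists (s' ** pi_vertex (Pullback bc : vgrp E z)).
by rewrite (pi_mapM _ (erefl : proj_r z = pv_w z)) pi_map_vertex Et.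
Qed.

End Projections.

(** * Components and full subgraphs *)

Section Walks.
Variable G : graph.
Implicit Types u v w : G.

Lemma walk_trans u v w : walk u v -> walk v w -> walk u w.
Proof. by move=> uv; elim=> // x y _ ux e; exact: walk_cons ux e. Qed.

Lemma walk_sym u v : walk u v -> walk v u.
Proof.
elim=> [|x y _ xu e]; first exact: walk_nil.
by apply: walk_trans xu; exact: walk_cons (walk_nil y) (einv e).
Qed.

Lemma component_eq u v : walk u v <-> component u = component v.
Proof.
split=> [uv|E]; last by rewrite -[walk u v]/(component u v) E; exact: walk_nil.
apply/seteqP; split=> w; first exact: walk_trans (walk_sym uv).
exact: walk_trans uv.
Qed.

End Walks.

Lemma walk_of_path (A : gog) (u v : A) (p : gpath u v) : walk u v.
Proof.
elim: p => [x _|x y z _ e _ yz]; first exact: walk_nil.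
by apply: walk_trans yz; exact: walk_cons (walk_nil x) e.
Qed.

Lemma path_of_walk (A : gog) (u v : A) : walk u v -> inhabited (pi_hom u v).
Proof.
elim=> [|x y _ [s] e]; first exact: inhabits (pi_vertex 1).
exact: inhabits (s ** pi_edge e).
Qed.

Section FullSubgraph.
Variables (A : gog) (P : set A).

Definition full_incl_graph : graph_mor (full_gog P) A :=
  @GraphMor (full_gog P) A (fun u => sval u) (fun _ _ e => e)
    (fun _ _ _ => erefl).

Definition full_incl : gog_mor (full_gog P) A :=
  @GogMor (full_gog P) A full_incl_graph
    (fun u => idfun) (fun u v e => idfun)
    (fun u => @inj_id _) (fun u v e => @inj_id _)
    (fun u v e => 1) (fun u v e => 1) (fun _ _ _ => erefl) (fun _ _ _ => erefl)
    (fun u v e x => esym (conjg1 _)) (fun u v e x => esym (conjg1 _)).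

Lemma full_incl_locally_injective : locally_injective full_incl.
Proof.
split.
  move=> v [v1 P1] [v2 P2] f1 f2 u u' e h b z; case: u / h e z => e z.
  move=> /over_edge_star E1 /over_edge_star E2 _ {z}.
  have [Ev Ef] := existT_eq (etrans E1 (esym E2)); simpl in Ev, Ef.
  by subst v2; simpl in Ef; subst f2; rewrite (Prop_irrelevance P1 P2).
move=> v v' f u u' e h b z oe; case: _ _ _ / oe h z => h z.
rewrite (Prop_irrelevance h erefl) /= mulg1 mul1g => ->; by exists z.
Qed.

Hypothesis P_closed : forall u v : A, edge u v -> P u -> P v.

Lemma full_incl_locally_surjective : locally_surjective full_incl.
Proof.
move=> [v Pv] u u' e h a; case: u / h e a => e a.
exists (exist _ u' (P_closed e Pv)), e, a, 1; split.
  exact: (Over_edge full_incl (v := exist _ v Pv)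
    (v' := exist _ u' (P_closed e Pv)) e).
by rewrite /= gmulf1 !mulg1.
Qed.

Lemma full_incl_path (x y : full_gog P) (s : pi_hom (sval x) (sval y)) :
  exists t : pi_hom x y, pi_map (mu := full_incl) erefl erefl t = s.
Proof.
have [z [hz [t [a ->]]]] := path_lifting s (erefl : full_incl x = sval x)
  full_incl_locally_surjective.
have Ez : z = y.
  case: z hz {t} => z Pz; case: y s a => y Py s a /= E.
  case: y / E Py s a => Py s a.
  by rewrite (Prop_irrelevance Pz Py).
case: y / Ez s a hz => s a hz.
exists (t ** pi_vertex (a : vgrp (full_gog P) z)).
rewrite (pi_mapM _ (erefl : full_incl z = sval z)) pi_map_vertex.
by rewrite (Prop_irrelevance hz erefl).
Qed.

Lemma full_walk (x y : full_gog P) : walk x y <-> walk (sval x) (sval y).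
Proof.
split=> [/path_of_walk [s]|/path_of_walk [s]].
  exact: walk_of_path (mor_path full_incl (repr s)).
by have [t _] := full_incl_path s; exact: walk_of_path (repr t).
Qed.

End FullSubgraph.

Lemma component_closed (A : gog) (u v w : A) :
  edge v w -> component u v -> component u w.
Proof. by move=> e uv; exact: walk_cons uv e. Qed.

(** The inclusion of a component is faithful and, being a covering, lifts the
    circuits of the component. *)
Lemma nontrivial_pi1_component (A : gog) (u : A) :
  nontrivial_pi1 (full_gog (component u)) <->
  exists v (s : pi_hom v v), walk u v /\ s <> pi_vertex 1.
Proof.
split=> [[[v uv] [s s1]]|[v [s [uv s1]]]].
  exists v, (pi_map (mu := full_incl (component u)) erefl erefl s); split=> //.
  move=> E; apply: s1; apply: (pi_map_inj (hv := erefl) (hw := erefl)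
    (@full_incl_locally_injective A (component u))).
  rewrite E -[X in _ = pi_map _ _ X]/(pi_vertex 1).
  by rewrite pi_map_vertex gmulf1.
have [t Et] := @full_incl_path A (component u) (@component_closed A u)
  (exist _ v uv) (exist _ v uv) s.
exists (exist _ v uv), t => t1; apply: s1.
by rewrite -Et t1 -[X in pi_map _ _ X]/(pi_vertex 1) pi_map_vertex gmulf1.
Qed.

Lemma nontrivial_closed (A : gog) (u v : A) : walk u v ->
  nontrivial_pi1 (full_gog (component u)) ->
  nontrivial_pi1 (full_gog (component v)).
Proof. by move=> /component_eq ->. Qed.

(** * The double coset attached to a vertex of the product *)

Section DoubleCosets.
Variables (A B C : gog) (muB : gog_mor B A) (muC : gog_mor C A).
Variables (u0 : A) (v0 : B) (w0 : C) (hv0 : muB v0 = u0) (hw0 : muC w0 = u0).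
Variables (p : forall v : B, gpath v0 v) (q : forall w : C, gpath w0 w).
Variable r : product_reps muB muC.
Notation E := (gog_product r).
Notation GB := (pi1_image muB hv0).
Notation GC := (pi1_image muC hw0).
Implicit Types x y : E.

Definition loop_class x (a : vgrp A (pv_u x)) : pi1 u0 :=
  pclass (vertex_loop hv0 hw0 p q x a).

Lemma loop_classE x a : loop_class a =
  pi_map hv0 (pv_hv x) (pclass (p (pv_v x))) ** pi_vertex a **
  pi_inv (pi_map hw0 (pv_hw x) (pclass (q (pv_w x)))).
Proof. by rewrite !pi_mapE pi_invE /pi_vertex !pi_mulE. Qed.

Lemma dcoset_pi1 (g g' : pi1 u0) :
  dcoset GB GC g g' <-> dcoset GB GC g = dcoset GB GC g'.
Proof.
split=> [|E'].
  by apply: dcosetP;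
    [exact: pi1_imageM|exact: pi1_imageV|exact: pi1_imageM|exact: pi1_imageV].
rewrite E'; exists 1, 1; split; rewrite ?mul1g ?mulg1 //.
  by have := pi1_image_map hv0 (pi_vertex 1); rewrite pi_map_vertex gmulf1.
by have := pi1_image_map hw0 (pi_vertex 1); rewrite pi_map_vertex gmulf1.
Qed.

(** Closing up with the base paths [p] and [q] translates between circuits of
    [B] and [C] and paths between the projections of [x] and [y]. *)
Lemma dcoset_loop_class x y (a : vgrp A (pv_u x)) (a' : vgrp A (pv_u y)) :
  dcoset GB GC (loop_class a) = dcoset GB GC (loop_class a') <->
  exists (s : pi_hom (pv_v x) (pv_v y)) (t : pi_hom (pv_w x) (pv_w y)),
    pi_map (pv_hv x) (pv_hv y) s ** pi_vertex a' =
    pi_vertex a ** pi_map (pv_hw x) (pv_hw y) t.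
Proof.
set bx := pclass (p (pv_v x)); set by' := pclass (p (pv_v y)).
set cx := pclass (q (pv_w x)); set cy := pclass (q (pv_w y)).
split.
  move=> /dcoset_pi1 [h [k [Hh Hk]]]; move: Hh Hk.
  rewrite !pi1_imageE => -[b _ <-] [c _ <-].
  rewrite !loop_classE -/bx -/by' -/cx -/cy => Eg.
  exists (pi_inv bx ** pi_inv b ** by'), (pi_inv cx ** c ** cy).
  rewrite !(pi_mapM _ hv0) !(pi_mapM _ hw0) !pi_mapV.
  have := congr1 (fun z => pi_inv (pi_map hv0 (pv_hv x) bx) **
    (pi_inv (pi_map hv0 hv0 b) ** z ** pi_map hw0 (pv_hw y) cy)) Eg.
  by rewrite -!pi_mul_pi1 !pi_mulA !pi_mulVK pi_mulV pi_mul1.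
move=> [s [t Est]]; apply/dcoset_pi1; rewrite !loop_classE -/bx -/by' -/cx -/cy.
exists (pi_map hv0 hv0 (by' ** pi_inv s ** pi_inv bx)),
  (pi_map hw0 hw0 (cx ** t ** pi_inv cy)).
split; [exact: pi1_image_map|exact: pi1_image_map|].
rewrite -!pi_mul_pi1 !(pi_mapM _ (pv_hv x)) !(pi_mapM _ (pv_hw y)).
rewrite !(pi_mapM _ (pv_hv y)) !(pi_mapM _ (pv_hw x)) !pi_mapV.
rewrite !pi_mulA !pi_mulVK; congr (_ ** _); rewrite -!pi_mulA -Est.
by rewrite pi_mulKV.
Qed.

Lemma dcoset_loop_vrep x a : pv_set x a ->
  dcoset GB GC (loop_class a) = dcoset GB GC (loop_class (vrep r x)).
Proof.
move=> Ha; apply/dcoset_loop_class; move: (vrepP r x).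
rewrite (pv_set_dcoset Ha) => -[_ [_ [[b _ <-] [c _ <-] ->]]].
exists (pi_vertex b^-1), (pi_vertex c); rewrite !pi_map_vertex -!pi_vertexM.
by rewrite gmulfV !mulgA mulVg mul1g.
Qed.

Lemma dcoset_loop_walk x y : walk x y ->
  dcoset GB GC (loop_class (vrep r x)) = dcoset GB GC (loop_class (vrep r y)).
Proof.
move=> /path_of_walk [s]; apply/dcoset_loop_class.
exists (pi_map (mu := proj_l r) erefl erefl s),
  (pi_map (mu := proj_r r) erefl erefl s).
exact: product_square.
Qed.

Lemma walk_dcoset_loop x y : locally_injective muB -> locally_surjective muB ->
  dcoset GB GC (loop_class (vrep r x)) = dcoset GB GC (loop_class (vrep r y)) ->
  walk x y.
Proof.
move=> inj surj /dcoset_loop_class [s [t Est]].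
have [s' _] := product_path inj surj Est; exact: walk_of_path (repr s').
Qed.

(** The circuit [s] projects to circuits of [B] and [C] whose images are
    conjugate by [g = loop_class (vrep r x)], by [product_square]; the image of
    the second is nontrivial because [proj_r] and [muC] are faithful. *)
Lemma conj_image_nontrivial x (s : pi_hom x x) :
  locally_injective muB -> locally_injective muC -> s <> pi_vertex 1 ->
  conj_set GB (loop_class (vrep r x)) `&` GC <> [set 1].
Proof.
move=> injB injC s1 Eg.
set b := pclass (p (pv_v x)); set c := pclass (q (pv_w x)).
pose sl := pi_map (mu := proj_l r) erefl erefl s.
pose sr := pi_map (mu := proj_r r) erefl erefl s.
pose beta : pi1 u0 := pi_map hv0 hv0 (b ** sl ** pi_inv b).
pose gamma : pi1 u0 := pi_map hw0 hw0 (c ** sr ** pi_inv c).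
have Ebg : beta * loop_class (vrep r x) = loop_class (vrep r x) * gamma.
  rewrite -!pi_mul_pi1 loop_classE /beta /gamma -/b -/c.
  rewrite !(pi_mapM _ (pv_hv x)) !(pi_mapM _ (pv_hw x)) !pi_mapV.
  rewrite !pi_mulA !pi_mulVK; congr (_ ** _); rewrite -!pi_mulA.
  congr (_ ** _); exact: product_square.
have : (conj_set GB (loop_class (vrep r x)) `&` GC) gamma.
  split; last exact: pi1_image_map.
  by exists beta; [exact: pi1_image_map|rewrite conjgE Ebg mulKg].
rewrite Eg => /= gamma1; apply: s1.
apply: (pi_map_inj (hv := erefl) (hw := erefl)
  (proj_r_locally_injective r injB)).
rewrite pi_map_vertex gmulf1; apply: (@pi_conj_eq1 C _ _ c).
apply: (pi_map_inj (hv := hw0) (hw := hw0) injC).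
by rewrite pi_map_vertex gmulf1 -[LHS]/gamma gamma1.
Qed.

(** The end of a lift of [g] to [B], together with [w0], is a vertex [x] of the
    product to which the double coset of [g] is attached.  An equation
    [beta ^ g = gamma] between nontrivial circuits then becomes an equation as
    in [product_square] at [x], and [product_path] turns it into a nontrivial
    circuit. *)
Lemma nontrivial_conj_image (g : pi1 u0) :
  locally_injective muB -> locally_surjective muB ->
  conj_set GB g `&` GC <> [set 1] ->
  exists2 x : E, (exists s : pi_hom x x, s <> pi_vertex 1) &
    dcoset GB GC (loop_class (vrep r x)) = dcoset GB GC g.
Proof.
move=> inj surj Hg.
have [gamma [[beta Hbeta Ebg] Hgamma gamma1]] : exists gamma,
    [/\ conj_set GB g gamma, GC gamma & gamma <> 1].
  apply: contra_notP Hg => Hg; apply/seteqP; split=> [c [Bc Cc]|_ ->] /=.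
    by apply: contra_notP Hg => c1; exists c.
  split; last first.
    by have := pi1_image_map hw0 (pi_vertex 1); rewrite pi_map_vertex gmulf1.
  exists 1; last exact: conj1g.
  by have := pi1_image_map hv0 (pi_vertex 1); rewrite pi_map_vertex gmulf1.
have [v [hv [t [a Eg]]]] := path_lifting g hv0 surj.
pose S := dcoset (range (vmap_at hv)) (range (vmap_at hw0)) a.
pose x : E := @PVertex _ _ _ muB muC u0 v w0 hv hw0 S (ex_intro _ _ erefl).
have Sa : pv_set x a.
  by exists 1, 1; split; rewrite ?mul1g ?mulg1 //; exists 1; rewrite // gmulf1.
exists x; last first.
  rewrite -(dcoset_loop_vrep Sa); apply/esym/dcoset_pi1.
  exists (pi_map hv0 hv0 (pclass (p v) ** pi_inv t)),
    (pi_map hw0 hw0 (pi_inv (pclass (q w0)))).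
  split; [exact: pi1_image_map|exact: pi1_image_map|].
  rewrite loop_classE -!pi_mul_pi1 Eg (pi_mapM _ hv) !pi_mapV !pi_mulA.
  by rewrite pi_mulVK.
move: Hbeta Hgamma; rewrite !pi1_imageE => -[b _ Eb] [c _ Ec].
have Ebc : pi_map hv hv (pi_inv t ** b ** t) ** pi_vertex a =
    pi_vertex a ** pi_map hw0 hw0 c.
  have Eq : beta * g = g * gamma by rewrite -Ebg conjgE mulVKg.
  rewrite -!pi_mul_pi1 Eg -Eb -Ec in Eq.
  rewrite !(pi_mapM _ hv0) pi_mapV -(pi_mulA _ _ (pi_vertex a)).
  by rewrite -(pi_mulA _ (pi_map hv0 hv0 b)) Eq -pi_mulA pi_mulKV.
move: (pi_inv t ** b ** t) Ebc => d Ebc.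
move: (vrepP r x).
rewrite (pv_set_dcoset Sa) => -[_ [_ [[b1 _ <-] [c1 _ <-] Ex]]].
(* Passing from [a] to the representative [vrep r x] conjugates both paths. *)
have [|s Es] := @product_path _ _ _ _ _ r x x
  (pi_vertex b1 ** d ** pi_inv (pi_vertex b1))
  (pi_inv (pi_vertex c1) ** c ** pi_vertex c1) inj surj.
  rewrite Ex !pi_vertexM !(pi_mapM _ (pv_hv x)) !(pi_mapM _ (pv_hw x)).
  rewrite !pi_mapV !pi_map_vertex !pi_mulA !pi_mulVK pi_mulK.
  congr (_ ** _); rewrite -!pi_mulA; congr (_ ** _); exact: Ebc.
exists s => s1; apply: gamma1; rewrite -Ec.
suff -> : c = pi_vertex 1 by rewrite pi_map_vertex gmulf1.
apply: (@pi_conj_eq1 C _ _ (pi_inv (pi_vertex c1))).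
by rewrite pi_invK -Es s1 pi_map_vertex gmulf1.
Qed.

End DoubleCosets.

Theorem theoremD (A B C : gog) (muB : gog_mor B A) (muC : gog_mor C A)
    (covB : covering muB) (immC : immersion muC)
    (connB : connected B) (connC : connected C)
    (u0 : A) (v0 : B) (w0 : C) (hv0 : muB v0 = u0) (hw0 : muC w0 = u0)
    (p : forall v : B, gpath v0 v) (q : forall w : C, gpath w0 w)
    (r : product_reps muB muC) :
  let D := nontrivial_part (gog_product r) in
  let GB := pi1_image muB hv0 in
  let GC := pi1_image muC hw0 in
  exists F : set D -> set (pi1 u0),
    (forall (x : D) (a : vgrp A (pv_u (sval x))), pv_set (sval x) a ->
       F (component x) =
       dcoset GB GC (pclass (vertex_loop hv0 hw0 p q (sval x) a))) /\
    set_bij (components D)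
      [set X | exists g : pi1 u0,
         conj_set GB g `&` GC <> [set 1] /\ X = dcoset GB GC g] F.
Proof.
move=> D GB GC.
have surjB := covering_locally_surjective covB.
have injB := immersion_locally_injective covB.1.
have injC := immersion_locally_injective immC.
have D_walk (x y : D) : walk x y <-> walk (sval x) (sval y).
  apply: full_walk => u v e; rewrite /=; apply: nontrivial_closed.
  exact: walk_cons (walk_nil u) e.
pose L (x : gog_product r) := dcoset GB GC (loop_class hv0 hw0 p q (vrep r x)).
pose F (X : set D) := [set g | exists x : D, X = component x /\ L (sval x) g].
have FE (x : D) : F (component x) = L (sval x).
  apply/seteqP; split=> [g [y [/component_eq /D_walk xy]]|g Lg]; last first.
    by exists x.
  by rewrite /L (dcoset_loop_walk hv0 hw0 p q xy).
exists F; split=> [x a Ha|].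
  rewrite FE -[RHS]/(dcoset GB GC (loop_class hv0 hw0 p q a)).
  by rewrite (dcoset_loop_vrep hv0 hw0 p q Ha).
split.
- move=> _ [x _ <-]; rewrite FE.
  have [y [s [xy s1]]] := (nontrivial_pi1_component (sval x)).1 (svalP x).
  exists (loop_class hv0 hw0 p q (vrep r y)).
  split; [exact: conj_image_nontrivial s1|exact: dcoset_loop_walk xy].
- move=> _ _ /set_mem [x _ <-] /set_mem [y _ <-]; rewrite !FE.
  by move=> /(walk_dcoset_loop injB surjB) /D_walk /component_eq.
- move=> _ [g [Hg ->]].
  have [x [s s1] Lx] := nontrivial_conj_image p q r injB surjB Hg.
  have Dx : nontrivial_pi1 (full_gog (component x)).
    by apply/nontrivial_pi1_component; exists x, s; split=> //; exact: walk_nil.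
  exists (component (exist _ x Dx : D)); first by exists (exist _ x Dx).
  by rewrite FE.
Qed.
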